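(* Let $m$ and $n$ be integers such that $m\ge n>0$. Then $$\mathrm{Ext}^{m-n}_{\mathcal F(\mathbf{gr})}\big(q_n(\bar P),\,T^m\circ\mathfrak a\big)\neq 0.$$
   Context: $\mathbf{gr}$ is a small skeleton of the category of finitely generated free groups, and $\mathcal F(\mathbf{gr})$ is the abelian category of functors from $\mathbf{gr}$ to the category of abelian groups. $\mathfrak a$ is the abelianization functor on $\mathbf{gr}$, and $T^m$ is the $m$-th tensor power functor over $\mathbb Z$. $\bar P\in\mathcal F(\mathbf{gr})$ is the reduced functor (vanishing on the trivial group) such that $\mathbb Z[\mathbf{gr}(\mathbb Z,-)]\simeq\mathbb Z\oplus\bar P$; thus $\bar P(G)$ is the augmentation ideal $IG$ of the group ring $\mathbb Z[G]$. $q_n$ is the left adjoint of the inclusion into $\mathcal F(\mathbf{gr})$ of the full subcategory of functors that are polynomial of degree $\le n$ in the sense of Eilenberg–MacLane (i.e. whose $(n+1)$-st cross effect, with respect to the free product, vanishes). There is a natural isomorphism $q_n(\bar P)(G)\simeq IG/I^{n+1}G$ for $G\in\mathbf{gr}$. *)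

(* Defs.v *)
From HB Require Import structures.
From mathcomp Require Import all_boot all_order all_algebra.
From mathcomp Require Import boolp.
From mathcomp Require Import freeg.

Set Implicit Arguments.
Unset Strict Implicit.
Unset Printing Implicit Defensive.

Import GRing.Theory.

Local Open Scope quotient_scope.
Local Open Scope ring_scope.

Notation group_hom := UMagmaMorphism.type.

Lemma group_hom_eq (G H : groupType) (f g : group_hom G H) : f =1 g -> f = g.
Proof.
case: f g => [f [[f1] [fM]]] [g [[g1] [gM]]] /= /funext fg.
case: _ / fg in g1 gM *.
by rewrite (Prop_irrelevance f1 g1) (Prop_irrelevance fM gM).
Qed.

Lemma additive_eq (U V : zmodType) (f g : {additive U -> V}) : f =1 g -> f = g.
Proof.
case: f g => [f [[fD]]] [g [[gD]]] /= /funext fg.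
case: _ / fg in gD *.
by rewrite (Prop_irrelevance fD gD).
Qed.

(* The letter (i, b) stands for x_i if b = false and for x_i^-1 if b = true. *)
Definition word (r : nat) := seq ('I_r * bool).

Inductive word_eq (r : nat) : word r -> word r -> Prop :=
| word_eq_cancel u v i b :
    word_eq (u ++ (i, b) :: (i, ~~ b) :: v) (u ++ v)
| word_eq_refl u : word_eq u u
| word_eq_sym u v : word_eq u v -> word_eq v u
| word_eq_trans u v w : word_eq u v -> word_eq v w -> word_eq u w.

Definition word_eqb r (u v : word r) : bool := `[< word_eq u v >].

Lemma word_eqb_equiv r : equiv_class_of (@word_eqb r).
Proof.
split=> [u|u v|v u w].
- exact/asboolP/word_eq_refl.
- by apply/asboolP/asboolP; apply: word_eq_sym.
- by move=> /asboolP uv /asboolP vw; apply/asboolP; apply: word_eq_trans uv vw.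
Qed.

Canonical word_eqb_equiv_rel r := EquivRelPack (@word_eqb_equiv r).
Canonical word_eqb_encModRel r := defaultEncModRel (@word_eqb r).

Definition free_group (r : nat) := {eq_quot @word_eqb r}.
HB.instance Definition _ r := Choice.on (free_group r).
HB.instance Definition _ r : EqQuotient _ (@word_eqb r) (free_group r) :=
  EqQuotient.on (free_group r).

Section FreeGroup.
Variable r : nat.
Implicit Types (u v w : word r) (x y z : free_group r).

Definition word_inv u : word r := rev [seq (l.1, ~~ l.2) | l <- u].

Lemma word_eqP u v : word_eq u v <-> \pi_(free_group r) u = \pi v.
Proof.
by split=> [uv|/eqmodP/asboolP //]; apply/eqmodP/asboolP.
Qed.

Lemma word_eq_catl w u v : word_eq u v -> word_eq (w ++ u) (w ++ v).
Proof.
elim=> {u v} [u v i b|u|u v _|u v t _ uv _].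
- by rewrite !catA; apply: word_eq_cancel.
- exact: word_eq_refl.
- exact: word_eq_sym.
- exact: word_eq_trans.
Qed.

Lemma word_eq_catr w u v : word_eq u v -> word_eq (u ++ w) (v ++ w).
Proof.
elim=> {u v} [u v i b|u|u v _|u v t _ uv _].
- by rewrite -!catA; apply: word_eq_cancel.
- exact: word_eq_refl.
- exact: word_eq_sym.
- exact: word_eq_trans.
Qed.

Lemma word_inv_cons i b u : word_inv ((i, b) :: u) = word_inv u ++ [:: (i, ~~ b)].
Proof. by rewrite /word_inv /= rev_cons cats1. Qed.

Lemma word_invK : involutive word_inv.
Proof.
move=> u; rewrite /word_inv map_rev revK -map_comp -[RHS]map_id.
by apply: eq_map => -[i b] /=; rewrite negbK.
Qed.

Lemma word_eq_mulV u : word_eq (u ++ word_inv u) [::].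
Proof.
elim: u => [|[i b] u IHu]; first exact: word_eq_refl.
rewrite word_inv_cons catA.
have := word_eq_catr [:: (i, ~~ b)] (word_eq_catl [:: (i, b)] IHu).
move/word_eq_trans; apply.
exact: (@word_eq_cancel r [::] [::] i b).
Qed.

Lemma word_eq_Vmul u : word_eq (word_inv u ++ u) [::].
Proof. by rewrite -{2}[u]word_invK; apply: word_eq_mulV. Qed.

Definition free_mul x y : free_group r := \pi_(free_group r) (repr x ++ repr y).
Definition free_one : free_group r := \pi_(free_group r) [::].
Definition free_inv x : free_group r := \pi_(free_group r) (word_inv (repr x)).

Lemma repr_word_eq u : word_eq (repr (\pi_(free_group r) u)) u.
Proof. by apply/word_eqP; rewrite reprK. Qed.

Lemma free_mul_pi u v : free_mul (\pi u) (\pi v) = \pi_(free_group r) (u ++ v).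
Proof.
apply/word_eqP; apply: (@word_eq_trans _ _ (u ++ repr (\pi_(free_group r) v))).
  exact/word_eq_catr/repr_word_eq.
exact/word_eq_catl/repr_word_eq.
Qed.

Lemma free_mulA : associative free_mul.
Proof.
by move=> x y z; rewrite -[x]reprK -[y]reprK -[z]reprK !free_mul_pi catA.
Qed.

Lemma free_mul1 : left_id free_one free_mul.
Proof. by move=> x; rewrite -[x]reprK free_mul_pi. Qed.

Lemma free_mulr1 : right_id free_one free_mul.
Proof. by move=> x; rewrite -[x]reprK free_mul_pi cats0. Qed.

Lemma free_mulV : left_inverse free_one free_inv free_mul.
Proof.
move=> x; rewrite -{2}[x]reprK free_mul_pi.
exact/word_eqP/word_eq_Vmul.
Qed.

Lemma free_mulrV : right_inverse free_one free_inv free_mul.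
Proof.
move=> x; rewrite -{1}[x]reprK free_mul_pi.
exact/word_eqP/word_eq_mulV.
Qed.

HB.instance Definition _ := isGroup.Build (free_group r)
  free_mulA free_mul1 free_mulr1 free_mulV free_mulrV.

Definition free_gen (i : 'I_r) : free_group r := \pi_(free_group r) [:: (i, false)].

Section Lift.
Variables (G : groupType) (f : 'I_r -> G).

Definition word_eval u : G :=
  (\prod_(l <- u) (if l.2 then (f l.1)^-1 else f l.1))%g.

Lemma word_eval_cat u v : word_eval (u ++ v) = (word_eval u * word_eval v)%g.
Proof. by rewrite /word_eval big_cat. Qed.

Lemma word_eval_eq u v : word_eq u v -> word_eval u = word_eval v.
Proof.
elim=> {u v} [u v i b|u|u v _|u v t _ uv _] //; last exact: etrans.
rewrite !word_eval_cat /word_eval !big_cons; congr (_ * _)%g.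
by case: b => /=; rewrite ?mulKg ?mulVKg.
Qed.

Definition free_lift x : G := word_eval (repr x).

Lemma free_lift_pi u : free_lift (\pi_(free_group r) u) = word_eval u.
Proof. exact/word_eval_eq/repr_word_eq. Qed.

Lemma free_liftM : {morph free_lift : x y / (x * y)%g >-> (x * y)%g}.
Proof.
move=> x y; rewrite -[x]reprK -[y]reprK -[(_ * _)%g in LHS]/(free_mul _ _).
by rewrite free_mul_pi !free_lift_pi word_eval_cat.
Qed.

Lemma free_lift1 : free_lift 1%g = 1%g.
Proof. by rewrite -[1%g]/free_one free_lift_pi /word_eval big_nil. Qed.

HB.instance Definition _ := isUMagmaMorphism.Build (free_group r) G free_lift
  (free_lift1, free_liftM).

Lemma free_lift_gen i : free_lift (free_gen i) = f i.
Proof. by rewrite free_lift_pi /word_eval big_seq1. Qed.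

End Lift.

End FreeGroup.

Definition commutator_subgroup (G : groupType) (x : G) : Prop :=
  forall H : {pred G}, group_closed H ->
    (forall a b : G, [~ a, b]%g \in H) -> x \in H.

Definition ab_eqb (G : groupType) (x y : G) : bool :=
  `[< commutator_subgroup (x^-1 * y)%g >].

Section CommutatorSubgroup.
Variable G : groupType.
Implicit Types x y : G.
Local Notation D := (@commutator_subgroup G).

Lemma commutator_subgroup1 : D 1%g.
Proof. by move=> H [H1 _]. Qed.

Lemma commutator_subgroupF x y : D x -> D y -> D (x / y)%g.
Proof. by move=> Dx Dy H gH cH; case: (gH) => _; apply; [apply: Dx|apply: Dy]. Qed.

Lemma commutator_subgroupV x : D x -> D (x^-1)%g.
Proof. by move/(commutator_subgroupF commutator_subgroup1); rewrite div1g. Qed.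

Lemma commutator_subgroupM x y : D x -> D y -> D (x * y)%g.
Proof.
by move=> Dx /commutator_subgroupV /(commutator_subgroupF Dx); rewrite invgK.
Qed.

Lemma commutator_subgroupR x y : D [~ x, y]%g.
Proof. by move=> H _; apply. Qed.

Lemma commutator_subgroupJ x y : D x -> D (x ^ y)%g.
Proof.
move=> Dx; have -> : (x ^ y = x * [~ x, y])%g by rewrite /commg mulVKg.
exact/commutator_subgroupM/commutator_subgroupR.
Qed.

Lemma ab_eqb_equiv : equiv_class_of (@ab_eqb G).
Proof.
split=> [x|x y|y x z].
- by apply/asboolP; rewrite mulVg; apply: commutator_subgroup1.
- by apply/asboolP/asboolP => /commutator_subgroupV; rewrite invgM invgK.
- move=> /asboolP xy /asboolP yz; apply/asboolP.
  by have := commutator_subgroupM xy yz; rewrite mulgA mulgK.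
Qed.
End CommutatorSubgroup.

Canonical ab_eqb_equiv_rel G := EquivRelPack (ab_eqb_equiv G).
Canonical ab_eqb_encModRel G := defaultEncModRel (@ab_eqb G).

Definition abelianization (G : groupType) := {eq_quot @ab_eqb G}.
HB.instance Definition _ G := Choice.on (abelianization G).
HB.instance Definition _ G : EqQuotient _ (@ab_eqb G) (abelianization G) :=
  EqQuotient.on (abelianization G).

Section Abelianization.
Variable G : groupType.
Implicit Types (g h : G) (x y z : abelianization G).

Lemma ab_eqP g h :
  commutator_subgroup (g^-1 * h)%g <-> \pi_(abelianization G) g = \pi h.
Proof. by split=> [gh|/eqmodP/asboolP //]; apply/eqmodP/asboolP. Qed.

Definition ab_add x y := \pi_(abelianization G) (repr x * repr y)%g.
Definition ab_zero := \pi_(abelianization G) 1%g.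
Definition ab_opp x := \pi_(abelianization G) (repr x)^-1%g.

Lemma ab_add_pi g h :
  ab_add (\pi g) (\pi h) = \pi_(abelianization G) (g * h)%g.
Proof.
apply/ab_eqP; set g' := repr _; set h' := repr _.
have gg' : commutator_subgroup (g'^-1 * g)%g by apply/ab_eqP; rewrite reprK.
have hh' : commutator_subgroup (h'^-1 * h)%g by apply/ab_eqP; rewrite reprK.
have -> : ((g' * h')^-1 * (g * h) = (g'^-1 * g) ^ h' * (h'^-1 * h))%g.
  by rewrite /conjg invgM !mulgA mulgK.
by apply: commutator_subgroupM => //; apply: commutator_subgroupJ.
Qed.

Lemma ab_addA : associative ab_add.
Proof. by move=> x y z; rewrite -[x]reprK -[y]reprK -[z]reprK !ab_add_pi mulgA. Qed.

Lemma ab_addC : commutative ab_add.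
Proof.
move=> x y; rewrite -[x]reprK -[y]reprK !ab_add_pi; apply/ab_eqP.
have -> : ((repr x * repr y)^-1 * (repr y * repr x) = [~ repr y, repr x])%g.
  by rewrite /commg /conjg invgM !mulgA.
exact: commutator_subgroupR.
Qed.

Lemma ab_add0 : left_id ab_zero ab_add.
Proof. by move=> x; rewrite -[x]reprK ab_add_pi mul1g. Qed.

Lemma ab_addN : left_inverse ab_zero ab_opp ab_add.
Proof. by move=> x; rewrite -{2}[x]reprK ab_add_pi mulVg. Qed.

HB.instance Definition _ := GRing.isZmodule.Build (abelianization G)
  ab_addA ab_addC ab_add0 ab_addN.

End Abelianization.

Section AbelianizationMap.
Variables (G H : groupType) (f : group_hom G H).

Definition ab_map (x : abelianization G) := \pi_(abelianization H) (f (repr x)).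

Lemma ab_map_pi g : ab_map (\pi g) = \pi_(abelianization H) (f g).
Proof.
apply/ab_eqP => K gK cK; rewrite -gmulfV -gmulfM.
set g' := repr _.
have: commutator_subgroup (g'^-1 * g)%g by apply/ab_eqP; rewrite reprK.
move=> /(_ [pred a | f a \in K]); apply.
  split; first by rewrite inE gmulf1; case: gK.
  by move=> a b; rewrite !inE gmulfF => fa fb; case: gK => _; apply.
by move=> a b; rewrite inE gmulfR.
Qed.

Lemma ab_map_is_nmod_morphism : nmod_morphism ab_map.
Proof.
split; first by rewrite -[0]/(ab_zero G) ab_map_pi gmulf1.
move=> x y; rewrite -[x]reprK -[y]reprK -[(_ + _) in LHS]/(ab_add _ _).
by rewrite ab_add_pi !ab_map_pi gmulfM -[RHS]/(ab_add _ _) ab_add_pi.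
Qed.

HB.instance Definition _ := GRing.isNmodMorphism.Build
  (abelianization G) (abelianization H) ab_map ab_map_is_nmod_morphism.

End AbelianizationMap.

Section FreeAbelian.
Variable K : choiceType.

Definition freeg_gen (k : K) : {freeg K} := << k >>.

Section Lift.
Variables (V : zmodType) (f : K -> V).

Definition freeg_lift (x : {freeg K}) : V := fglift (f : K -> zmodule V) x.

Lemma freeg_lift_is_additive : zmod_morphism freeg_lift.
Proof. exact: (lift_is_additive (f : K -> zmodule V)). Qed.

HB.instance Definition _ :=
  GRing.isZmodMorphism.Build {freeg K} V freeg_lift freeg_lift_is_additive.

Lemma freeg_liftU k : freeg_lift (freeg_gen k) = f k.
Proof. by rewrite /freeg_lift /freeg_gen liftU scale1r. Qed.
End Lift.

Lemma freeg_additive_eq (V : zmodType) (f g : {additive {freeg K} -> V}) :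
  (forall k, f (freeg_gen k) = g (freeg_gen k)) -> f =1 g.
Proof.
move=> fg x; rewrite -[x]freeg_sumE !raddf_sum; apply: eq_bigr => k _.
by rewrite -[coeff k x]intz -freegU_mulz !raddfMz (fg k).
Qed.
End FreeAbelian.

Section Kernel.
Variables (U V : zmodType) (f : {additive U -> V}).

Definition ker_pred : {pred U} := [pred x | f x == 0].

Lemma ker_pred_zmod_closed : zmod_closed ker_pred.
Proof.
split=> [|x y]; rewrite !inE ?raddf0 //.
by move=> /eqP fx /eqP fy; rewrite raddfB fx fy subrr.
Qed.

HB.instance Definition _ := GRing.isZmodClosed.Build U ker_pred
  ker_pred_zmod_closed.

Record kernel := Kernel { kernel_val : U; _ : kernel_val \in ker_pred }.

HB.instance Definition _ := [isSub for kernel_val].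
HB.instance Definition _ := [Choice of kernel by <:].
HB.instance Definition _ := [SubChoice_isSubZmodule of kernel by <:].

Lemma kernelP (x : kernel) : f (val x) = 0.
Proof. by case: x => x /= /eqP. Qed.

Lemma ker_predP x : f x = 0 -> x \in ker_pred.
Proof. by move=> fx; apply/eqP. Qed.
End Kernel.

Section Span.
Variables (V : zmodType) (S : V -> Prop).

Definition span_pred : {pred V} := fun x =>
  `[< forall H : {pred V}, zmod_closed H -> (forall y, S y -> y \in H) ->
        x \in H >].

Lemma span_pred_zmod_closed : zmod_closed span_pred.
Proof.
split=> [|x y].
  by apply/asboolP => H [].
move=> /asboolP Sx /asboolP Sy; apply/asboolP => H cH SH.
by case: (cH) => _; apply; [apply: Sx|apply: Sy].
Qed.

HB.instance Definition _ := GRing.isZmodClosed.Build V span_pred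
  span_pred_zmod_closed.

Lemma mem_span y : S y -> y \in span_pred.
Proof. by move=> Sy; apply/asboolP => H _; apply. Qed.

Lemma span_pred_ind (W : zmodType) (f : {additive V -> W}) :
  (forall y, S y -> f y = 0) -> {in span_pred, forall x, f x = 0}.
Proof.
move=> fS x /asboolP /(_ (ker_pred f) (ker_pred_zmod_closed f)) fx.
by apply/eqP/fx => y /fS fy; apply/eqP.
Qed.
End Span.

Section QuotientLift.
Variables (U V : zmodType) (I : zmodClosed U) (f : {additive U -> V}).

Lemma quot_pi_eq x y :
  x - y \in I <-> \pi_(Quotient.quot I) x = \pi_(Quotient.quot I) y.
Proof.
by split=> [xy|/eqP]; [apply/eqP|]; rewrite -?Quotient.idealrBE.
Qed.

Hypothesis fI : {in I, forall x, f x = 0}.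

Definition quot_lift of {in I, forall x, f x = 0} :=
  fun x : Quotient.quot I => f (repr x).

Lemma quot_lift_pi x : quot_lift fI (\pi x) = f x.
Proof.
apply/eqP; rewrite -subr_eq0 -raddfB /=; apply/eqP/fI.
by apply/quot_pi_eq; rewrite reprK.
Qed.

Lemma quot_lift_is_additive : zmod_morphism (quot_lift fI).
Proof.
move=> x y; rewrite -[x]reprK -[y]reprK -[_ - _ in LHS]raddfB.
by rewrite !quot_lift_pi raddfB.
Qed.

HB.instance Definition _ := GRing.isZmodMorphism.Build
  (Quotient.quot I) V (quot_lift fI) quot_lift_is_additive.
End QuotientLift.

(* The m-th tensor power over the integers is the free abelian group on m-tuples,
   encoded as functions on 'I_m, modulo additivity in each variable. Over the
   integers, compatibility with scalars follows from additivity. *)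
Section TensorPower.
Variable m : nat.

Definition tensor_rel (A : zmodType) (x : {freeg {ffun 'I_m -> A}}) : Prop :=
  exists i (t t1 t2 : {ffun 'I_m -> A}),
    [/\ t i = t1 i + t2 i,
        forall j, j != i -> t j = t1 j /\ t j = t2 j
      & x = freeg_gen t - freeg_gen t1 - freeg_gen t2].

Definition tensor_power (A : zmodType) :=
  Quotient.quot (span_pred (@tensor_rel A)).
HB.instance Definition _ (A : zmodType) := GRing.Zmodule.on (tensor_power A).

Definition tensor (A : zmodType) (t : {ffun 'I_m -> A}) : tensor_power A :=
  \pi_(tensor_power A) (freeg_gen t).
End TensorPower.

Lemma tensor_power_additive_eq m (A V : zmodType)
    (f g : {additive tensor_power m A -> V}) :
  (forall t, f (tensor t) = g (tensor t)) -> f =1 g.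
Proof.
move=> fg x; rewrite -[x]reprK.
pose p : {freeg {ffun 'I_m -> A}} -> tensor_power m A :=
  \pi_(Quotient.quot (span_pred (@tensor_rel m A))).
pose pA := GRing.isZmodMorphism.Build _ _ p (@raddfB _ _ \pi_(Quotient.quot (span_pred (@tensor_rel m A)))).
pose P : {additive _ -> _} := HB.pack p pA.
exact: (@freeg_additive_eq _ _ (f \o P) (g \o P)).
Qed.

Section TensorMap.
Variables (m : nat) (A B : zmodType) (f : {additive A -> B}).

Definition tensor_map_pre : {freeg {ffun 'I_m -> A}} -> tensor_power m B :=
  freeg_lift (fun t : {ffun 'I_m -> A} => tensor [ffun i : 'I_m => f (t i)]).
HB.instance Definition _ := GRing.Additive.on tensor_map_pre.

Lemma tensor_map_preU (t : {ffun 'I_m -> A}) :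
  tensor_map_pre (freeg_gen t) = tensor [ffun i => f (t i)].
Proof. exact: freeg_liftU. Qed.

Lemma tensor_map_rel :
  {in span_pred (@tensor_rel m A), forall x, tensor_map_pre x = 0}.
Proof.
apply: span_pred_ind => _ [i [t [t1 [t2 [ti tj ->]]]]].
rewrite !raddfB /= !tensor_map_preU /tensor -!raddfB.
rewrite -[RHS](raddf0 \pi_(tensor_power m B)).
apply/quot_pi_eq; rewrite subr0; apply: mem_span.
exists i, [ffun i => f (t i)], [ffun i => f (t1 i)], [ffun i => f (t2 i)].
split=> [|j /tj[tj1 tj2]|//]; rewrite !ffunE; first by rewrite ti raddfD.
by rewrite -tj1 -tj2.
Qed.

Definition tensor_map : tensor_power m A -> tensor_power m B :=
  quot_lift tensor_map_rel.
HB.instance Definition _ := GRing.Additive.on tensor_map.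

Lemma tensor_mapE t : tensor_map (tensor t) = tensor [ffun i => f (t i)].
Proof. by rewrite -tensor_map_preU [LHS]quot_lift_pi. Qed.
End TensorMap.

(* The skeleton gr of the category of finitely generated free groups: the objects
   are the natural numbers, r standing for the free group of rank r. *)
Definition gr (s r : nat) := group_hom (free_group s) (free_group r).
Definition gr_id (r : nat) : gr r r := idfun.
Definition gr_comp r s t (g : gr s t) (f : gr r s) : gr r t := g \o f.

Record functor := Functor {
  fobj :> nat -> zmodType;
  fmap : forall s r, gr s r -> {additive fobj s -> fobj r};
  fmap_id : forall r (x : fobj r), fmap (gr_id r) x = x;
  fmap_comp : forall r s t (g : gr s t) (f : gr r s) (x : fobj r),
    fmap (gr_comp g f) x = fmap g (fmap f x)
}.
Arguments fmap F {s r} f : rename.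

Record nat_trans (F G : functor) := NatTrans {
  nt_app :> forall r, {additive F r -> G r};
  nt_natural : forall s r (f : gr s r) (x : F s),
    nt_app r (fmap F f x) = fmap G f (nt_app s x)
}.

Lemma nat_trans_eq F G (a b : nat_trans F G) :
  (forall r (x : F r), a r x = b r x) -> a = b.
Proof.
case: a b => [a aN] [b bN] /= ab.
have {}ab : a = b by apply: functional_extensionality_dep => r; apply/additive_eq/ab.
case: _ / ab in bN *; congr NatTrans; exact: Prop_irrelevance.
Qed.

HB.instance Definition _ F G := gen_eqMixin (nat_trans F G).
HB.instance Definition _ F G := gen_choiceMixin (nat_trans F G).

Section NatTransZmod.
Variables F G : functor.
Implicit Types a b : nat_trans F G.

Lemma nt_zero_natural s r (f : gr s r) (x : F s) :
  (\0 : {additive F r -> G r}) (fmap F f x) = fmap G f ((\0 : {additive F s -> G s}) x).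
Proof. by rewrite /= raddf0. Qed.
Definition nt_zero := @NatTrans F G (fun r => \0) nt_zero_natural.

Lemma nt_add_natural a b s r (f : gr s r) (x : F s) :
  (a r \+ b r : {additive F r -> G r}) (fmap F f x)
    = fmap G f ((a s \+ b s : {additive F s -> G s}) x).
Proof. by rewrite /= !nt_natural raddfD. Qed.
Definition nt_add a b := @NatTrans F G (fun r => a r \+ b r) (nt_add_natural a b).

Lemma nt_opp_natural a s r (f : gr s r) (x : F s) :
  (\- a r : {additive F r -> G r}) (fmap F f x)
    = fmap G f ((\- a s : {additive F s -> G s}) x).
Proof. by rewrite /= !nt_natural raddfN. Qed.
Definition nt_opp a := @NatTrans F G (fun r => \- a r) (nt_opp_natural a).

Lemma nt_addA : associative nt_add.
Proof. by move=> a b c; apply: nat_trans_eq => r x /=; rewrite addrA. Qed.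
Lemma nt_addC : commutative nt_add.
Proof. by move=> a b; apply: nat_trans_eq => r x /=; rewrite addrC. Qed.
Lemma nt_add0 : left_id nt_zero nt_add.
Proof. by move=> a; apply: nat_trans_eq => r x /=; rewrite add0r. Qed.
Lemma nt_addN : left_inverse nt_zero nt_opp nt_add.
Proof. by move=> a; apply: nat_trans_eq => r x /=; rewrite addNr. Qed.

HB.instance Definition _ := GRing.isZmodule.Build (nat_trans F G)
  nt_addA nt_addC nt_add0 nt_addN.
End NatTransZmod.

Section NatTransComp.
Variables F G H : functor.

Lemma nt_comp_natural (b : nat_trans G H) (a : nat_trans F G) s r (f : gr s r)
    (x : F s) :
  (b r \o a r : {additive F r -> H r}) (fmap F f x)
    = fmap H f ((b s \o a s : {additive F s -> H s}) x).
Proof. by rewrite /= !nt_natural. Qed.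
Definition nt_comp (b : nat_trans G H) (a : nat_trans F G) : nat_trans F H :=
  NatTrans (nt_comp_natural b a).

Definition nt_precomp (a : nat_trans F G) (b : nat_trans G H) := nt_comp b a.

Lemma nt_precomp_is_additive a : zmod_morphism (nt_precomp a).
Proof. by move=> b c; apply: nat_trans_eq. Qed.
HB.instance Definition _ a := GRing.isZmodMorphism.Build
  (nat_trans G H) (nat_trans F H) (nt_precomp a) (nt_precomp_is_additive a).
End NatTransComp.

Section KernelFunctor.
Variables (F G : functor) (a : nat_trans F G).

Section Map.
Variables (s r : nat) (f : gr s r).

Lemma kernel_map_subproof (x : kernel (a s)) :
  fmap F f (val x) \in ker_pred (a r).
Proof. by apply: ker_predP; rewrite nt_natural kernelP raddf0. Qed.
Definition kernel_map (x : kernel (a s)) : kernel (a r) :=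
  Kernel (kernel_map_subproof x).
Lemma kernel_map_is_additive : zmod_morphism kernel_map.
Proof. by move=> x y; apply: val_inj; rewrite /= !raddfB. Qed.
HB.instance Definition _ := GRing.isZmodMorphism.Build
  (kernel (a s)) (kernel (a r)) kernel_map kernel_map_is_additive.
End Map.

Lemma kernel_map_id r (x : kernel (a r)) : kernel_map (gr_id r) x = x.
Proof. by apply: val_inj; rewrite /= fmap_id. Qed.
Lemma kernel_map_comp r s t (g : gr s t) (f : gr r s) (x : kernel (a r)) :
  kernel_map (gr_comp g f) x = kernel_map g (kernel_map f x).
Proof. by apply: val_inj; rewrite /= fmap_comp. Qed.

Definition kernel_functor : functor :=
  @Functor (fun r => kernel (a r)) (fun s r f => kernel_map f)
    kernel_map_id kernel_map_comp.

Lemma kernel_incl_natural s r (f : gr s r) (x : kernel_functor s) :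
  (val : {additive kernel (a r) -> F r}) (fmap kernel_functor f x)
    = fmap F f ((val : {additive kernel (a s) -> F s}) x).
Proof. by []. Qed.
Definition kernel_incl : nat_trans kernel_functor F :=
  @NatTrans kernel_functor F (fun r => val) kernel_incl_natural.
End KernelFunctor.

Definition const_functor (V : zmodType) : functor :=
  @Functor (fun=> V) (fun s r _ => idfun) (fun r x => erefl)
    (fun r s t g f x => erefl).

Lemma ab_map_id r (x : abelianization (free_group r)) : ab_map (gr_id r) x = x.
Proof. by rewrite -[x]reprK ab_map_pi. Qed.
Lemma ab_map_comp r s t (g : gr s t) (f : gr r s)
    (x : abelianization (free_group r)) :
  ab_map (gr_comp g f) x = ab_map g (ab_map f x).
Proof. by rewrite -[x]reprK (ab_map_pi f) (ab_map_pi g) ab_map_pi. Qed.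
Definition ab_functor : functor :=
  @Functor (fun r => abelianization (free_group r)) (fun s r f => ab_map f)
    ab_map_id ab_map_comp.

(* The composite of F with the m-th tensor power. *)
Section TensorFunctor.
Variables (m : nat) (F : functor).
Lemma tensor_fmap_id r (x : tensor_power m (F r)) :
  tensor_map (fmap F (gr_id r)) x = x.
Proof.
apply: (tensor_power_additive_eq (g := idfun)) => t; rewrite [LHS]tensor_mapE.
by congr tensor; apply/ffunP => i; rewrite ffunE fmap_id.
Qed.
Lemma tensor_fmap_comp r s t (g : gr s t) (f : gr r s)
    (x : tensor_power m (F r)) :
  tensor_map (fmap F (gr_comp g f)) x = tensor_map (fmap F g) (tensor_map (fmap F f) x).
Proof.
apply: (tensor_power_additive_eq
  (g := tensor_map (fmap F g) \o tensor_map (fmap F f))) => u.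
rewrite [LHS]tensor_mapE /= !tensor_mapE; congr tensor.
by apply/ffunP => i; rewrite !ffunE fmap_comp.
Qed.
Definition tensor_functor : functor :=
  @Functor (fun r => tensor_power m (F r)) (fun s r f => tensor_map (fmap F f))
    tensor_fmap_id tensor_fmap_comp.
End TensorFunctor.
Section Linearization.
Variables (X : nat -> choiceType) (act : forall s r, gr s r -> X s -> X r).
Hypothesis act_id : forall r (x : X r), act (gr_id r) x = x.
Hypothesis act_comp : forall r s t (g : gr s t) (f : gr r s) (x : X r),
  act (gr_comp g f) x = act g (act f x).

Definition lin_map s r (f : gr s r) : {freeg (X s)} -> {freeg (X r)} :=
  freeg_lift (fun x => freeg_gen (act f x)).
HB.instance Definition _ s r (f : gr s r) := GRing.Additive.on (lin_map f).

Lemma lin_mapU s r (f : gr s r) x :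
  lin_map f (freeg_gen x) = freeg_gen (act f x).
Proof. exact: freeg_liftU. Qed.

Lemma lin_map_id r (x : {freeg (X r)}) : lin_map (gr_id r) x = x.
Proof.
apply: (freeg_additive_eq (g := idfun)) => k.
by rewrite [LHS]lin_mapU act_id.
Qed.

Lemma lin_map_comp r s t (g : gr s t) (f : gr r s) (x : {freeg (X r)}) :
  lin_map (gr_comp g f) x = lin_map g (lin_map f x).
Proof.
apply: (freeg_additive_eq (g := lin_map g \o lin_map f)) => k.
by rewrite [LHS]lin_mapU /= !lin_mapU act_comp.
Qed.

Definition linearization : functor :=
  @Functor (fun r => {freeg (X r)}) (fun s r f => lin_map f)
    lin_map_id lin_map_comp.

Section Lift.
Variables (G : functor) (h : forall r, X r -> G r).
Hypothesis h_natural : forall s r (f : gr s r) (x : X s),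
  h (act f x) = fmap G f (h x).

Lemma lin_lift_natural s r (f : gr s r) (x : linearization s) :
  freeg_lift (@h r) (fmap linearization f x) = fmap G f (freeg_lift (@h s) x).
Proof.
apply: (freeg_additive_eq (f := freeg_lift (@h r) \o lin_map f)
  (g := fmap G f \o freeg_lift (@h s))) => k.
by rewrite /= lin_mapU !freeg_liftU.
Qed.

Definition lin_lift : nat_trans linearization G :=
  @NatTrans linearization G (fun r => freeg_lift (@h r)) lin_lift_natural.
End Lift.
End Linearization.

Definition repr_act a s r (f : gr s r) (g : {classic (gr a s)}) :
  {classic (gr a r)} := gr_comp f g.
Lemma repr_act_id a r (g : {classic (gr a r)}) : repr_act (gr_id r) g = g.
Proof. exact: group_hom_eq. Qed.
Lemma repr_act_comp a r s t (g : gr s t) (f : gr r s) (x : {classic (gr a r)}) :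
  repr_act (gr_comp g f) x = repr_act g (repr_act f x).
Proof. exact: group_hom_eq. Qed.

(* Z[gr(Z^{*a}, -)], where Z^{*a} is the free group of rank a. *)
Definition repr_functor (a : nat) : functor :=
  linearization (@repr_act_id a) (@repr_act_comp a).

Definition aug a r : {additive repr_functor a r -> int} :=
  @deg {classic (gr a r)}.

Lemma aug_natural a s r (f : gr s r) (x : repr_functor a s) :
  aug a r (fmap (repr_functor a) f x) = fmap (const_functor int) f (aug a s x).
Proof.
apply: (freeg_additive_eq (f := aug a r \o fmap (repr_functor a) f)
  (g := aug a s)) => k.
by rewrite /= lin_mapU /freeg_gen !degU.
Qed.

Definition augmentation a : nat_trans (repr_functor a) (const_functor int) :=
  @NatTrans (repr_functor a) (const_functor int) (aug a) (@aug_natural a).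

(* The augmentation splits off the constant functor Z from Z[gr(Z, -)]; its kernel
   is the reduced summand, r |-> augmentation ideal of Z[free_group r]. *)
Definition Pbar : functor := kernel_functor (augmentation 1).

Section FreeProduct.
Variables (k : nat) (r_ : 'I_k -> nat).

(* In gr the free product of the objects r_ i is \sum_i r_ i. *)
Definition free_product_incl (i : 'I_k) : gr (r_ i) (\sum_i r_ i)%N :=
  free_lift (fun j : 'I_(r_ i) => free_gen (tagnat.Rank i j)).

Definition free_product_lift t (f : forall i, gr (r_ i) t) :
    gr (\sum_i r_ i)%N t :=
  free_lift (fun u => f (tagnat.sig1 u) (free_gen (tagnat.sig2 u))).
End FreeProduct.

(* The projection of the free product of k + 1 groups onto the free product of
   all of them except the i-th one. *)
Definition free_product_omit k (r_ : 'I_k.+1 -> nat) (i : 'I_k.+1) :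
    gr (\sum_j r_ j)%N (\sum_(j < k) r_ (fintype.lift i j))%N :=
  free_product_lift (fun j : 'I_k.+1 =>
    match unliftP i j in unlift_spec _ _ _
    return gr (r_ j) (\sum_(j < k) r_ (fintype.lift i j))%N with
    | UnliftSome j' e =>
        ecast l (gr (r_ l) _) (esym e)
          (free_product_incl (fun j => r_ (fintype.lift i j)) j')
    | UnliftNone _ => one_fun _
    end).

Lemma free_product_omit_incl k (r_ : 'I_k.+1 -> nat) i j (x : 'I_(r_ (fintype.lift i j))) :
  free_product_omit r_ i (free_gen (tagnat.Rank (fintype.lift i j) x))
    = free_gen (tagnat.Rank j x).
Proof.
rewrite [LHS]free_lift_gen /tagnat.sig1 /tagnat.sig2 tagnat.rankK /=.
case: unliftP => [j' e|e]; last by case/negP: (neq_lift i j); apply/eqP/esym.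
have ej := lift_inj e; case: _ / ej in e *.
rewrite (eq_irrelevance e erefl) /=.
exact: free_lift_gen.
Qed.

Lemma free_product_omit_self k (r_ : 'I_k.+1 -> nat) i (x : 'I_(r_ i)) :
  free_product_omit r_ i (free_gen (tagnat.Rank i x)) = 1%g.
Proof.
rewrite [LHS]free_lift_gen /tagnat.sig1 /tagnat.sig2 tagnat.rankK /=.
by case: unliftP => [j' e|//]; case/negP: (neq_lift i j'); apply/eqP.
Qed.

(* The kernel of the map from F of the free product of k + 1 groups to the product
   of the values of F on the k + 1 partial free products. *)
Definition cross_effect (F : functor) k (r_ : 'I_k.+1 -> nat)
    (x : F (\sum_i r_ i)%N) : Prop :=
  forall i, fmap F (free_product_omit r_ i) x = 0.

Definition polynomial_functor (n : nat) (F : functor) : Prop :=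
  forall (r_ : 'I_n.+1 -> nat) (x : F (\sum_i r_ i)%N),
    cross_effect x -> x = 0.

(* qn n is the left adjoint of the inclusion of the polynomial functors of degree
   at most n into all functors: qn n F is the largest quotient of F that is
   polynomial of degree at most n. The adjunction is qn_polynomial together with
   qn_universal. *)
Section PolynomialQuotient.
Variables (n : nat) (F : functor).

Definition qn_ker r : {pred F r} := fun x =>
  `[< forall (G : functor) (a : nat_trans F G), polynomial_functor n G -> a r x = 0 >].

Lemma qn_ker_zmod_closed r : zmod_closed (@qn_ker r).
Proof.
split=> [|x y].
  by apply/asboolP => G a _; rewrite raddf0.
move=> /asboolP qx /asboolP qy; apply/asboolP => G a pG.
by rewrite raddfB (qx _ _ pG) (qy _ _ pG) subrr.
Qed.
HB.instance Definition _ r := GRing.isZmodClosed.Build (F r) (@qn_ker r)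
  (@qn_ker_zmod_closed r).

Definition qn_obj r : zmodType := Quotient.quot (@qn_ker r).
Definition qn_pi r : {additive F r -> qn_obj r} := \pi_(Quotient.quot (@qn_ker r)).

Lemma qn_pi_surj r (y : qn_obj r) : exists x, qn_pi r x = y.
Proof. by exists (repr y); rewrite /qn_pi /= reprK. Qed.

Lemma qn_map_ker s r (f : gr s r) :
  {in @qn_ker s, forall x, (qn_pi r \o fmap F f) x = 0}.
Proof.
move=> x /asboolP qx; rewrite /= -[RHS](raddf0 (qn_pi r)).
apply/quot_pi_eq; rewrite subr0; apply/asboolP => G a pG.
by rewrite nt_natural (qx _ _ pG) raddf0.
Qed.

Definition qn_map s r (f : gr s r) : {additive qn_obj s -> qn_obj r} :=
  quot_lift (qn_map_ker f).

Lemma qn_mapE s r (f : gr s r) x : qn_map f (qn_pi s x) = qn_pi r (fmap F f x).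
Proof. exact: quot_lift_pi. Qed.

Lemma qn_map_id r (x : qn_obj r) : qn_map (gr_id r) x = x.
Proof. by have [y <-] := qn_pi_surj x; rewrite [LHS]qn_mapE fmap_id. Qed.
Lemma qn_map_comp r s t (g : gr s t) (f : gr r s) (x : qn_obj r) :
  qn_map (gr_comp g f) x = qn_map g (qn_map f x).
Proof.
have [y <-] := qn_pi_surj x; rewrite [LHS]qn_mapE fmap_comp.
by rewrite -(qn_mapE g) -(qn_mapE f).
Qed.

Definition qn : functor := @Functor qn_obj (fun s r f => qn_map f)
  qn_map_id qn_map_comp.

Lemma qn_unit_natural s r (f : gr s r) (x : F s) :
  qn_pi r (fmap F f x) = fmap qn f (qn_pi s x).
Proof. by rewrite [RHS]qn_mapE. Qed.
Definition qn_unit : nat_trans F qn := @NatTrans F qn qn_pi qn_unit_natural.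

Section Factor.
Variables (G : functor) (pG : polynomial_functor n G) (a : nat_trans F G).

Lemma qn_factor_ker r : {in @qn_ker r, forall x, a r x = 0}.
Proof. by move=> x /asboolP; apply. Qed.
Definition qn_factor_app r : {additive qn r -> G r} := quot_lift (@qn_factor_ker r).
Lemma qn_factorE r x : qn_factor_app r (qn_unit r x) = a r x.
Proof. exact: quot_lift_pi. Qed.
Lemma qn_factor_natural s r (f : gr s r) (x : qn s) :
  qn_factor_app r (fmap qn f x) = fmap G f (qn_factor_app s x).
Proof.
have [y <-] := qn_pi_surj x.
by rewrite -qn_unit_natural !qn_factorE nt_natural.
Qed.
Definition qn_factor : nat_trans qn G := NatTrans qn_factor_natural.
End Factor.

Theorem qn_polynomial : polynomial_functor n qn.
Proof.
move=> r_ x; have [y <-] := qn_pi_surj x => cy.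
rewrite -[RHS](raddf0 (qn_pi _)).
apply/quot_pi_eq; rewrite subr0; apply/asboolP => G a pG.
apply: (pG) => i; rewrite -nt_natural -(qn_factorE pG) [qn_unit _ _]qn_unit_natural.
by rewrite cy raddf0.
Qed.

Theorem qn_universal (G : functor) (a : nat_trans F G) : polynomial_functor n G ->
  exists! b : nat_trans qn G, nt_comp b qn_unit = a.
Proof.
move=> pG; exists (qn_factor pG a); split.
  by apply: nat_trans_eq => r x /=; rewrite [LHS]qn_factorE.
move=> b ba; apply: nat_trans_eq => r x; have [y <-] := qn_pi_surj x.
by rewrite [LHS]qn_factorE -ba.
Qed.
End PolynomialQuotient.

(* Exactness in the functor category is pointwise; in particular epimorphisms are
   the pointwise surjections. *)
Definition projective_functor (P : functor) : Prop :=
  forall (A B : functor) (p : nat_trans A B),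
    (forall r (y : B r), exists x, p r x = y) ->
  forall f : nat_trans P B, exists g : nat_trans P A, nt_comp p g = f.

Record proj_resolution (F : functor) := ProjResolution {
  res_obj :> nat -> functor;
  res_d : forall k, nat_trans (res_obj k.+1) (res_obj k);
  res_aug : nat_trans (res_obj 0) F;
  res_projective : forall k, projective_functor (res_obj k);
  res_aug_surj : forall r (y : F r), exists x, res_aug r x = y;
  res_aug_exact : forall r (x : res_obj 0 r),
    res_aug r x = 0 <-> exists y, res_d 0 r y = x;
  res_exact : forall k r (x : res_obj k.+1 r),
    res_d k r x = 0 <-> exists y, res_d k.+1 r y = x
}.

Section FreeCover.
Variable F : functor.

Definition cover_gens (r : nat) := {classic {t : nat & (gr t r * F t)%type}}.
Definition cover_act s r (f : gr s r) (x : cover_gens s) : cover_gens r :=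
  existT _ (projT1 x) (gr_comp f (projT2 x).1, (projT2 x).2).
Lemma cover_act_id r (x : cover_gens r) : cover_act (gr_id r) x = x.
Proof.
case: x => t [g x]; congr existT; congr pair.
exact: group_hom_eq.
Qed.
Lemma cover_act_comp r s t (g : gr s t) (f : gr r s) (x : cover_gens r) :
  cover_act (gr_comp g f) x = cover_act g (cover_act f x).
Proof. by congr existT; congr pair; apply: group_hom_eq. Qed.

Definition cover : functor := linearization cover_act_id cover_act_comp.

Definition cover_gen t (x : F t) : cover t :=
  freeg_gen (existT _ t (gr_id t, x) : cover_gens t).

Lemma cover_ev_natural s r (f : gr s r) (x : cover_gens s) :
  (fun y : cover_gens r => fmap F (projT2 y).1 (projT2 y).2) (cover_act f x)
    = fmap F f (fmap F (projT2 x).1 (projT2 x).2).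
Proof. by rewrite /= fmap_comp. Qed.
Definition cover_ev : nat_trans cover F :=
  lin_lift cover_act_id cover_act_comp cover_ev_natural.

Lemma cover_ev_surj r (y : F r) : exists x, cover_ev r x = y.
Proof. by exists (cover_gen y); rewrite [LHS]freeg_liftU /= fmap_id. Qed.

Lemma cover_projective : projective_functor cover.
Proof.
move=> A B p p_surj f.
have [h hP] : { h : forall t (x : F t), A t |
    forall t x, p t (h t x) = f t (cover_gen x) }.
  exists (fun t x => projT1 (cid (p_surj t (f t (cover_gen x))))).
  by move=> t x; case: cid.
pose H r (y : cover_gens r) : A r := fmap A (projT2 y).1 (h _ (projT2 y).2).
have Hn s r (g : gr s r) (x : cover_gens s) :
    H r (cover_act g x) = fmap A g (H s x) by rewrite /H /= fmap_comp.
exists (lin_lift cover_act_id cover_act_comp Hn).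
apply: nat_trans_eq => r.
apply: (freeg_additive_eq (f := p r \o freeg_lift (H r)) (g := f r)).
case=> t [g x]; rewrite /= freeg_liftU /H /= nt_natural hP -nt_natural.
rewrite [in LHS]/= lin_mapU; congr (f r (freeg_gen _)).
by congr existT; congr pair; apply: group_hom_eq.
Qed.
End FreeCover.

Section StandardResolution.
Variable F : functor.

Fixpoint syzygy (k : nat) : functor :=
  if k is k'.+1 then kernel_functor (cover_ev (syzygy k')) else F.

Definition std_d k : nat_trans (cover (syzygy k.+1)) (cover (syzygy k)) :=
  nt_comp (kernel_incl (cover_ev (syzygy k))) (cover_ev (syzygy k.+1)).

Lemma std_exact k r (x : cover (syzygy k) r) :
  cover_ev (syzygy k) r x = 0 <-> exists y, std_d k r y = x.
Proof.
split=> [x0|[y <-]]; last exact: kernelP.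
have [y yx] := cover_ev_surj (Kernel (ker_predP x0) : syzygy k.+1 r).
by exists y; rewrite /= yx.
Qed.

Lemma std_d_exact k r (x : cover (syzygy k.+1) r) :
  std_d k r x = 0 <-> exists y, std_d k.+1 r y = x.
Proof.
rewrite -std_exact; split=> [x0|x0]; last by rewrite /= x0.
exact: val_inj.
Qed.

Definition std_resolution : proj_resolution F :=
  @ProjResolution F (fun k => cover (syzygy k)) std_d (cover_ev F)
    (fun k => @cover_projective (syzygy k)) (@cover_ev_surj F) (@std_exact 0)
    std_d_exact.
End StandardResolution.

(* The k-th cohomology group of the complex Hom(P_*, G). *)
Section ExtOf.
Variables (F : functor) (P : proj_resolution F) (G : functor) (k : nat).

Definition cocycle := kernel (nt_precomp (res_d P k) : {additive nat_trans (P k) G -> _}).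

Definition coboundary : {pred cocycle} := fun c =>
  `[< match k return nat_trans (P k) G -> Prop with
      | 0%N => fun a => a = 0
      | k'.+1 => fun a => exists b : nat_trans (P k') G, nt_precomp (res_d P k') b = a
      end (val c) >].

Lemma coboundary_zmod_closed : zmod_closed coboundary.
Proof.
rewrite /coboundary /cocycle; case: k => [|k']; split=> [|x y].
- exact/asboolP.
- move=> /asboolP x0 /asboolP y0; apply/asboolP.
  by rewrite [LHS](raddfB val) [X in X - _]x0 [X in _ - X]y0 subrr.
- by apply/asboolP; exists 0; rewrite raddf0.
- move=> /asboolP[a ax] /asboolP[b bx]; apply/asboolP; exists (a - b).
  by rewrite [RHS](raddfB val) [LHS]raddfB; congr (_ - _); [exact: ax|exact: bx].
Qed.
HB.instance Definition _ := GRing.isZmodClosed.Build cocycle coboundary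
  coboundary_zmod_closed.

Definition ext_of : zmodType := Quotient.quot coboundary.
End ExtOf.

(* The right derived functors of Hom; up to isomorphism they do not depend on the
   chosen projective resolution. *)
Definition Ext (k : nat) (F G : functor) : zmodType :=
  ext_of (std_resolution F) G k.

(* Main.v *)
(* The augmentation ideal I of Z[G] filters Pbar, and for a free group G the quotient
   I^n / I^(n+1) is the n-th tensor power of G^ab; in particular the universal
   polynomial quotient of degree n of Pbar kills no more than I^(n+1), on which taking
   the leading (degree n + 1) term of the Magnus expansion is natural.

   For m = n the map g - 1 |-> g (x) ... (x) g kills I^(n+1), hence gives a nonzero
   element of Hom. For m > n one builds a Yoneda product in degree m - n: first the
   extension of q_n(Pbar) by T^(n+1) obtained by pushing Pbar out along the leading
   term, then, for each N > n, the extension of T^N by T^(N+1) obtained by replacing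
   the last letter of a tensor by its quadratic Magnus term.

   Such a class is detected by evaluating cocycles on elements z_k of the k-th term of
   a resolution, at the free group of rank n + k: d z_1 is (x_0 - 1)...(x_n - 1) z_0
   and d z_(k+1) the image of z_k under a bar differential. The product cocycle takes
   the value +-x_0 (x) ... (x) x_(m-1) on z_(m-n), up to a boundary. The determinant of
   exponent sums is +-1 on that tensor, but vanishes on everything that comes from a
   free group of rank < m, such as a boundary or the value of a coboundary. *)
Require Import Defs.
From HB Require Import structures.
From mathcomp Require Import all_boot all_order all_algebra zify.
From mathcomp Require Import boolp.
From mathcomp Require Import freeg.

Set Implicit Arguments.
Unset Strict Implicit.
Unset Printing Implicit Defensive.

Import GRing.Theory.

Local Open Scope quotient_scope.
Local Open Scope ring_scope.

(** * Free groups, abelianizations and tensor powers *)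

Section FreeGroupTheory.
Variable r : nat.
Implicit Types (g h : free_group r) (u v : word r).

Lemma pi_cat u v :
  \pi_(free_group r) (u ++ v) = (\pi_(free_group r) u * \pi_(free_group r) v)%g.
Proof. by rewrite -[RHS]/(free_mul _ _) free_mul_pi. Qed.

Lemma pi_letter a b :
  \pi_(free_group r) [:: (a, b)] = if b then (free_gen a)^-1%g else free_gen a.
Proof.
case: b => //; apply: (@mulgI _ (free_gen a)); rewrite mulgV -pi_cat.
exact/word_eqP/(@word_eq_cancel r [::] [::] a false).
Qed.


Lemma free_group_ind (P : free_group r -> Prop) : P 1%g ->
    (forall a g, P g -> P (free_gen a * g)%g) ->
    (forall a g, P g -> P ((free_gen a)^-1 * g)%g) ->
  forall g, P g.
Proof.
move=> P1 PM PV g; rewrite -[g]reprK.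
elim: (repr g) => [//|[a b] u Pu].
by rewrite -cat1s pi_cat pi_letter; case: b; [apply: PV|apply: PM].
Qed.

Lemma free_hom_eq s (e f : gr r s) :
  (forall a, e (free_gen a) = f (free_gen a)) -> e =1 f.
Proof.
move=> ef; apply: free_group_ind => [|a g efg|a g efg].
- by rewrite !gmulf1.
- by rewrite !gmulfM ef efg.
- by rewrite !gmulfM !gmulfV ef efg.
Qed.

(** Letters are indexed by natural numbers, with value 1 out of range, so that shifts and faces of
    tuples are plain operations on sequences. *)
Definition gen (a : nat) : free_group r :=
  if insub a is Some i then free_gen i else 1%g.

Lemma gen_ord (a : 'I_r) : gen a = free_gen a.
Proof. by rewrite /gen valK. Qed.

Definition subst s (g : nat -> free_group s) : gr r s :=
  free_lift (fun a : 'I_r => g a).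

Lemma subst_gen s (g : nat -> free_group s) a :
  (a < r)%N -> subst g (gen a) = g a.
Proof. by move=> ar; rewrite -[a]/(val (Ordinal ar)) gen_ord [LHS]free_lift_gen. Qed.

End FreeGroupTheory.

Local Notation abpi g := (\pi_(abelianization _) g).

Section Abelianization.
Variable G : groupType.

Lemma abpiM (g h : G) : abpi (g * h)%g = abpi g + abpi h.
Proof. by rewrite -[RHS]/(ab_add _ _) ab_add_pi. Qed.

Lemma abpi1 : abpi (1%g : G) = 0.
Proof. by []. Qed.

Lemma abpiV (g : G) : abpi (g^-1)%g = - abpi g.
Proof. by apply: (addrI (abpi g)); rewrite -abpiM mulgV abpi1 subrr. Qed.

Section Lift.
Variables (V : zmodType) (f : G -> V).
Hypothesis fM : forall g h, f (g * h)%g = f g + f h.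

Let f1 : f 1%g = 0.
Proof. by apply: (addrI (f 1%g)); rewrite -fM mul1g addr0. Qed.

Let fV g : f (g^-1)%g = - f g.
Proof. by apply: (addrI (f g)); rewrite -fM mulgV f1 subrr. Qed.

(** The additivity of [f] is kept as an argument so that the additive structure can be attached to
    [ab_lift fM]. *)
Definition ab_lift & (forall g h, f (g * h)%g = f g + f h) :=
  fun x : abelianization G => f (repr x).

Lemma ab_lift_pi g : ab_lift fM (abpi g) = f g.
Proof.
rewrite /ab_lift; set h := repr _.
have: commutator_subgroup (g^-1 * h)%g by apply/ab_eqP; rewrite reprK.
(* The zeros of [f] form a subgroup containing all commutators, since the target is abelian. *)
move=> /(_ [pred a | f a == 0]) /=; rewrite inE fM fV addrC subr_eq0.
move=> fE; apply/eqP/fE.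
  by split=> [|a b]; rewrite !inE ?f1 // fM fV => /eqP -> /eqP ->; rewrite subrr.
by move=> a b; rewrite inE /commg /conjg !fM !fV [f a + _]addrC addKr addNr.
Qed.

Lemma ab_lift_is_additive : zmod_morphism (ab_lift fM).
Proof.
move=> x y; rewrite -[x]reprK -[y]reprK -abpiV -abpiM.
by rewrite !ab_lift_pi fM fV.
Qed.
HB.instance Definition _ := GRing.isZmodMorphism.Build
  (abelianization G) V (ab_lift fM) ab_lift_is_additive.
End Lift.
End Abelianization.

Lemma ab_additive_eq r (V : zmodType)
    (f g : {additive abelianization (free_group r) -> V}) :
  (forall a, f (abpi (free_gen a)) = g (abpi (free_gen a))) -> f =1 g.
Proof.
move=> fg x; rewrite -[x]reprK.
elim/free_group_ind: {x}(repr x) => [|a h IH|a h IH].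
- by rewrite abpi1 !raddf0.
- by rewrite abpiM !raddfD /= fg IH.
- by rewrite abpiM abpiV !raddfD !raddfN /= fg IH.
Qed.

Section TensorTheory.
Variable A : zmodType.

Lemma tensorD m i (t t1 t2 : {ffun 'I_m -> A}) : t i = t1 i + t2 i ->
  (forall j, j != i -> t j = t1 j /\ t j = t2 j) ->
  tensor t = tensor t1 + tensor t2.
Proof.
move=> ti tj; apply/eqP; rewrite -subr_eq0 opprD addrA /tensor -!raddfB; apply/eqP.
rewrite -[RHS](raddf0 \pi_(tensor_power m A)).
apply/quot_pi_eq; rewrite subr0; apply: mem_span.
by exists i, t, t1, t2.
Qed.

Definition multiadditive m (V : zmodType) (phi : {ffun 'I_m -> A} -> V) :=
  forall i (t t1 t2 : {ffun 'I_m -> A}), t i = t1 i + t2 i ->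
  (forall j, j != i -> t j = t1 j /\ t j = t2 j) -> phi t = phi t1 + phi t2.

Section Lift.
Variables (m : nat) (V : zmodType) (phi : {ffun 'I_m -> A} -> V).
Hypothesis phiD : multiadditive phi.

Lemma tensor_lift_rel :
  {in span_pred (@tensor_rel m A), forall x, freeg_lift phi x = 0}.
Proof.
apply: span_pred_ind => _ [i [t [t1 [t2 [ti tj ->]]]]].
by rewrite !raddfB /= !freeg_liftU (phiD ti tj) addrAC addrK subrr.
Qed.

Definition tensor_lift : tensor_power m A -> V := quot_lift tensor_lift_rel.
HB.instance Definition _ := GRing.Additive.on tensor_lift.

Lemma tensor_liftE t : tensor_lift (tensor t) = phi t.
Proof. by rewrite -(freeg_liftU phi) [LHS]quot_lift_pi. Qed.
End Lift.

Section Prepend.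
Variable m : nat.
Implicit Types (v : A) (t : {ffun 'I_m -> A}) (x : tensor_power m A).

Definition consf v t : {ffun 'I_m.+1 -> A} := [ffun i => oapp t v (unlift ord0 i)].

Lemma consf0 v t : consf v t ord0 = v.
Proof. by rewrite ffunE unlift_none. Qed.

Lemma consf_lift v t i : consf v t (fintype.lift ord0 i) = t i.
Proof. by rewrite ffunE liftK. Qed.

Lemma consf_multiadditive v : multiadditive (fun t => tensor (consf v t)).
Proof.
move=> i t t1 t2 ti tj; apply: (@tensorD _ (fintype.lift ord0 i)).
  by rewrite !consf_lift.
move=> j; have [k ->|->] := unliftP ord0 j; last by rewrite !consf0.
by rewrite !consf_lift (inj_eq lift_inj) => /tj.
Qed.

Definition prepend v : tensor_power m A -> tensor_power m.+1 A :=
  tensor_lift (consf_multiadditive v).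
HB.instance Definition _ v := GRing.Additive.on (prepend v).

Lemma prependE v t : prepend v (tensor t) = tensor (consf v t).
Proof. exact: tensor_liftE. Qed.

Lemma prependDl v w x : prepend (v + w) x = prepend v x + prepend w x.
Proof.
apply: (tensor_power_additive_eq (g := prepend v \+ prepend w)) => t /=.
rewrite !prependE; apply: (@tensorD _ ord0); first by rewrite !consf0.
move=> j; have [k ->|->] := unliftP ord0 j; last by rewrite eqxx.
by rewrite !consf_lift.
Qed.

Lemma prepend0l x : prepend 0 x = 0.
Proof. by apply: (addrI (prepend 0 x)); rewrite -prependDl !addr0. Qed.

Lemma prependNl v x : prepend (- v) x = - prepend v x.
Proof. by apply: (addrI (prepend v x)); rewrite -prependDl !subrr prepend0l. Qed.
End Prepend.

Definition tpure m (v : nat -> A) : tensor_power m A := tensor [ffun i : 'I_m => v i].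

Lemma tpureS m v : tpure m.+1 v = prepend (v 0%N) (tpure m (v \o succn)).
Proof.
rewrite prependE; congr tensor; apply/ffunP => i.
have [k ->|->] := unliftP ord0 i; last by rewrite consf0 ffunE.
by rewrite consf_lift !ffunE.
Qed.

Lemma eq_tpure m v w : (forall i, (i < m)%N -> v i = w i) -> tpure m v = tpure m w.
Proof. by move=> vw; congr tensor; apply/ffunP => i; rewrite !ffunE vw. Qed.

End TensorTheory.

Lemma tensor_map_prepend (A B : zmodType) (f : {additive A -> B}) m v
    (x : tensor_power m A) :
  tensor_map f (prepend v x) = prepend (f v) (tensor_map f x).
Proof.
apply: (tensor_power_additive_eq (f := @tensor_map _ _ _ f \o prepend v)
  (g := prepend (f v) \o @tensor_map _ _ _ f)) => t /=.
rewrite prependE !tensor_mapE prependE; congr tensor; apply/ffunP => i.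
by have [k ->|->] := unliftP ord0 i; rewrite ffunE ?consf_lift ?consf0 ?ffunE.
Qed.

Lemma tensor_map_tpure (A B : zmodType) (f : {additive A -> B}) m v :
  tensor_map f (tpure m v) = tpure m (f \o v).
Proof. by rewrite tensor_mapE; congr tensor; apply/ffunP => i; rewrite !ffunE. Qed.

(** * Powers of the augmentation ideal *)

Lemma span_ind (V : zmodType) (S P : V -> Prop) : P 0 ->
    (forall x y, P x -> P y -> P (x - y)) -> (forall y, S y -> P y) ->
  {in span_pred S, forall x, P x}.
Proof.
move=> P0 PB PS x /asboolP /(_ (fun x => `[< P x >])) Px; apply/asboolP/Px.
  by split=> [|y z /asboolP Py /asboolP Pz]; apply/asboolP => //; apply: PB.
by move=> y /PS Py; apply/asboolP.
Qed.

Lemma freeg_ind (K : choiceType) (P : {freeg K} -> Prop) : P 0 ->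
    (forall x y, P x -> P y -> P (x - y)) -> (forall k, P (freeg_gen k)) ->
  forall x, P x.
Proof.
move=> P0 PB PU x; have PN y : P y -> P (- y) by rewrite -sub0r; apply: PB.
have PD y z : P y -> P z -> P (y + z).
  by move=> Py /PN Pz; rewrite -[z]opprK; apply: PB.
rewrite -[x]freeg_sumE; elim/big_ind: _ => // k _.
rewrite -[coeff k x]intz -freegU_mulz -/(freeg_gen k).
have PUn n : P (freeg_gen k *+ n) by elim: n => // n IHn; rewrite mulrS; apply: PD.
by case: (coeff k x) => n; rewrite ?NegzE ?mulrNz; [|apply: PN]; apply: PUn.
Qed.

Definition elt_act s r (f : gr s r) (g : free_group s) : free_group r := f g.

Lemma elt_act_id r (g : free_group r) : elt_act (gr_id r) g = g.
Proof. by []. Qed.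

Lemma elt_act_comp r s t (g : gr s t) (f : gr r s) (x : free_group r) :
  elt_act (gr_comp g f) x = elt_act g (elt_act f x).
Proof. by []. Qed.

(** Another model of [repr_functor 1], with group elements in place of homomorphisms from the free
    group of rank one. *)
Definition group_ring : functor := linearization elt_act_id elt_act_comp.

Local Notation ZG r := {freeg (free_group r)}.

Section GroupRing.
Variable r : nat.
Implicit Types (g h : free_group r) (x y z : ZG r).

Definition lmul g : ZG r -> ZG r := freeg_lift (fun h => freeg_gen (g * h)%g).
HB.instance Definition _ g := GRing.Additive.on (lmul g).

Lemma lmulU g h : lmul g (freeg_gen h) = freeg_gen (g * h)%g.
Proof. exact: freeg_liftU. Qed.

Lemma lmul1 x : lmul 1%g x = x.
Proof. by apply: (freeg_additive_eq (g := idfun)) => k /=; rewrite lmulU mul1g. Qed.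

Lemma lmulM g h x : lmul (g * h)%g x = lmul g (lmul h x).
Proof.
by apply: (freeg_additive_eq (g := lmul g \o lmul h)) => k /=; rewrite !lmulU mulgA.
Qed.

(* [Jpow n] is I^n, I being the augmentation ideal. *)
Fixpoint Jpow n : ZG r -> Prop :=
  if n is n'.+1 then
    fun x => x \in span_pred (fun z => exists g y, Jpow n' y /\ z = lmul g y - y)
  else fun=> True.

Lemma Jpow0 n : Jpow n 0.
Proof. by case: n => //= n; apply: rpred0. Qed.

Lemma JpowB n x y : Jpow n x -> Jpow n y -> Jpow n (x - y).
Proof. by case: n => //= n; apply: rpredB. Qed.

Lemma JpowD n x y : Jpow n x -> Jpow n y -> Jpow n (x + y).
Proof. by case: n => //= n; apply: rpredD. Qed.

Lemma JpowS n g y : Jpow n y -> Jpow n.+1 (lmul g y - y).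
Proof. by move=> Jy; apply: mem_span; exists g, y. Qed.

Lemma JpowS_ind (P : ZG r -> Prop) n : P 0 ->
    (forall x y, P x -> P y -> P (x - y)) ->
    (forall g y, Jpow n y -> P (lmul g y - y)) ->
  forall x, Jpow n.+1 x -> P x.
Proof. by move=> P0 PB PJ; apply: span_ind => // _ [g [y [Jy ->]]]; apply: PJ. Qed.

Arguments Jpow : simpl never.

Lemma Jpow_sub n x : Jpow n.+1 x -> Jpow n x.
Proof.
elim: n x => // n IHn; apply: JpowS_ind; [exact: Jpow0|exact: JpowB|].
by move=> g y /IHn; apply: JpowS.
Qed.

Lemma Jpow_lmul n g x : Jpow n x -> Jpow n (lmul g x).
Proof. by move=> Jx; rewrite -[lmul _ _](subrK x); apply/JpowD/Jx/Jpow_sub/JpowS. Qed.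

Lemma Jpow_lmulE n g x : Jpow n (lmul g x) -> Jpow n x.
Proof. by move/(Jpow_lmul g^-1%g); rewrite -lmulM mulVg lmul1. Qed.

(** This is the product (g 0 - 1)...(g (k - 1) - 1) in the group ring. *)
Fixpoint dprod k (g : nat -> free_group r) : ZG r :=
  if k is k'.+1 then
    lmul (g 0%N) (dprod k' (g \o succn)) - dprod k' (g \o succn)
  else freeg_gen 1%g.

Lemma eq_dprod k (g h : nat -> free_group r) :
  (forall i, (i < k)%N -> g i = h i) -> dprod k g = dprod k h.
Proof.
elim: k g h => //= k IHk g h gh; rewrite (gh 0%N) //.
by rewrite (IHk (g \o succn) (h \o succn)) // => i ik; apply: gh.
Qed.

Lemma dprod_eq0 k (g : nat -> free_group r) i : (i < k)%N -> g i = 1%g -> dprod k g = 0.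
Proof.
elim: k g i => // k IHk g [|i] ik gi /=; first by rewrite gi lmul1 subrr.
by rewrite (IHk _ i) // raddf0 subrr.
Qed.

Lemma Jpow_dprod k (g : nat -> free_group r) : Jpow k (dprod k g).
Proof. by elim: k g => //= k IHk g; apply: JpowS. Qed.

(* Fox derivative with respect to x_a, with the rule d(g h) = d(g) h + d(h). *)
Fixpoint fox_word (a : 'I_r) (u : word r) : ZG r :=
  if u is (b, s) :: u' then
    fox_word a u' + (if b == a then
      if s then - freeg_gen (\pi_(free_group r) u) else freeg_gen (\pi_(free_group r) u')
    else 0)
  else 0.

(** The two letters of a cancelling pair contribute opposite terms, and every earlier letter only
    sees the class of a suffix. *)
Lemma fox_word_eq a u v : word_eq u v -> fox_word a u = fox_word a v.
Proof.
elim=> {u v} [u v b s|u|u v _|u v w _ uv _] //; last exact: etrans.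
have cancel w :
    \pi_(free_group r) (w ++ [:: (b, s), (b, ~~ s) & v]) = \pi_(free_group r) (w ++ v).
  exact/word_eqP/word_eq_cancel.
elim: u => [|[c t] u IHu]; last by rewrite /= IHu cancel -!cat_cons cancel.
rewrite /= -addrA -[RHS]addr0; congr (_ + _); case: eqP => [_|_]; last by rewrite addr0.
rewrite (cancel [::]).
by case: (s); rewrite ?subrr ?addNr.
Qed.

Definition fox (a : 'I_r) : ZG r -> ZG r :=
  freeg_lift (fun g => fox_word a (repr g)).
HB.instance Definition _ a := GRing.Additive.on (fox a).

Lemma fox1 a : fox a (freeg_gen 1%g) = 0.
Proof. by rewrite [LHS]freeg_liftU (fox_word_eq _ (@repr_word_eq r [::])). Qed.

Lemma fox_lmul a b x :
  fox a (lmul (free_gen b) x) = fox a x + (if b == a then x else 0).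
Proof.
(* The extra term is turned into an additive map of [x], so that comparing values on group elements
   suffices. *)
have -> : (if b == a then x else 0) =
    freeg_lift (fun h => if b == a then freeg_gen h else 0) x.
  case: eqP => _.
    by apply: (freeg_additive_eq (f := idfun)) => k /=; rewrite freeg_liftU.
  by apply: (freeg_additive_eq (f := \0)) => k /=; rewrite freeg_liftU.
move: x; apply: (freeg_additive_eq (f := fox a \o lmul (free_gen b))
  (g := fox a \+ freeg_lift _)) => h.
rewrite /= lmulU /= [LHS]freeg_liftU [fox a _]freeg_liftU freeg_liftU.
rewrite (@fox_word_eq a _ ((b, false) :: repr h)) /= ?reprK //.
by apply/word_eqP; rewrite reprK -cat1s pi_cat reprK pi_letter.
Qed.

Definition one_tensor (A : zmodType) : tensor_power 0 A := tpure 0 (fun=> 0).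

Lemma tpure0 (A : zmodType) (v : nat -> A) : tpure 0 v = one_tensor A.
Proof. exact: eq_tpure. Qed.

(* Up to the identification of I^n / I^(n+1) with the n-th tensor power, [lead n] is
   the degree n part of the Magnus expansion; it is natural on I^n only. *)
Fixpoint lead n : ZG r -> tensor_power n (abelianization (free_group r)) :=
  if n is n'.+1 then
    fun y => \sum_a prepend (abpi (free_gen a)) (lead n' (fox a y))
  else freeg_lift (fun=> one_tensor _).

Arguments lead : simpl never.

Lemma leadSE n y :
  lead n.+1 y = \sum_a prepend (abpi (free_gen a)) (lead n (fox a y)).
Proof. by []. Qed.

Lemma lead0U g : lead 0 (freeg_gen g) = one_tensor _.
Proof. exact: freeg_liftU. Qed.

Lemma lead_is_additive n : zmod_morphism (lead n).
Proof.
elim: n => [|n IHn] x y; first exact: raddfB.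
by rewrite !leadSE -sumrB; apply: eq_bigr => a _; rewrite raddfB IHn raddfB.
Qed.
HB.instance Definition _ n := GRing.isZmodMorphism.Build _ _ (lead n) (lead_is_additive n).

Lemma leadB n x y : lead n (x - y) = lead n x - lead n y.
Proof. exact: raddfB. Qed.

Lemma leadS1 n : lead n.+1 (freeg_gen 1%g) = 0.
Proof. by rewrite leadSE big1 // => a _; rewrite fox1 !raddf0. Qed.

(** By the Fox rule only the summand of [a] changes. For a single generator this holds on the whole
    group ring, without any filtration. *)
Lemma lead_lmul n a x :
  lead n.+1 (lmul (free_gen a) x) = lead n.+1 x + prepend (abpi (free_gen a)) (lead n x).
Proof.
rewrite !leadSE [X in _ + X](_ : _ =
  \sum_b if b == a then prepend (abpi (free_gen b)) (lead n x) else 0).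
  rewrite -big_split; apply: eq_bigr => b _ /=.
  by rewrite fox_lmul eq_sym !raddfD; case: eqP => // _; rewrite !raddf0.
by rewrite -big_mkcond big_pred1_eq.
Qed.

(** The claims feed each other: vanishing on I^(n+1) makes [lead n] invariant under left
    multiplication on I^n, which extends [lead_lmul] from generators to all g; that rule in turn
    gives the vanishing in degree n + 1. *)
Lemma lead_Jpow n :
  (forall y, Jpow n.+1 y -> lead n y = 0) /\
  (forall g y, Jpow n y -> lead n.+1 (lmul g y - y) = prepend (abpi g) (lead n y)).
Proof.
have leadS k : (forall y, Jpow k.+1 y -> lead k y = 0) ->
    forall g y, Jpow k y -> lead k.+1 (lmul g y - y) = prepend (abpi g) (lead k y).
  move=> leadJ g y Jy; rewrite raddfB /=.
  have lead_inv h : lead k (lmul h y) = lead k y.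
    by apply/eqP; rewrite -subr_eq0 -raddfB; apply/eqP/leadJ/JpowS.
  elim/free_group_ind: g => [|a g IH|a g IH].
  - by rewrite lmul1 subrr abpi1 prepend0l.
  - by rewrite lmulM lead_lmul lead_inv abpiM prependDl -IH addrAC [LHS]addrC.
  - rewrite abpiM abpiV prependDl prependNl -IH.
    (* Writing g as x_a (x_a^-1 g) lets the rule for x_a be read backwards. *)
    rewrite -[in RHS](mulVKg (free_gen a) g) [in RHS]lmulM lead_lmul lead_inv.
    by rewrite [RHS]addrC addrAC addrK.
elim: n => [|n [IHn IHS]]; last first.
  have JS : forall y, Jpow n.+2 y -> lead n.+1 y = 0.
    apply: JpowS_ind => [|x y x0 y0|g y Jy]; first exact: raddf0.
      by rewrite raddfB /= x0 y0 subrr.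
    by rewrite IHS ?IHn ?raddf0 //; apply: Jpow_sub.
  by split=> //; apply: leadS.
(* [lead 0] is the augmentation, with values in T^0, hence invariant under left multiplication. *)
suff J0 y : Jpow 1 y -> lead 0 y = 0 by split=> //; apply: leadS.
move: y; apply: JpowS_ind => [|x y x0 y0|g y _]; [exact: raddf0| |].
  by rewrite raddfB /= x0 y0 subrr.
rewrite raddfB /=; apply/eqP; rewrite subr_eq0; apply/eqP.
apply: (freeg_additive_eq (f := lead 0 \o lmul g) (g := lead 0)) => h /=.
by rewrite lmulU !lead0U.
Qed.

Lemma lead_eq0 n y : Jpow n.+1 y -> lead n y = 0.
Proof. exact: (lead_Jpow n).1. Qed.

Lemma leadS n g y : Jpow n y -> lead n.+1 (lmul g y - y) = prepend (abpi g) (lead n y).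
Proof. exact: (lead_Jpow n).2. Qed.

Lemma lead_dprod n (g : nat -> free_group r) :
  lead n (dprod n g) = tpure n (fun i => abpi (g i)).
Proof.
elim: n g => [|n IHn] g; first by rewrite lead0U tpure0.
by rewrite leadS ?IHn ?tpureS //; apply: Jpow_dprod.
Qed.

Definition lead2 g := lead 2 (freeg_gen g).

(** Take the leading term of gh - g - h + 1 = (g - 1)(h - 1), which lies in I^2. *)
Lemma lead2M g h :
  lead2 (g * h)%g = lead2 g + lead2 h +
    prepend (abpi g) (prepend (abpi h) (one_tensor _)).
Proof.
rewrite -(lead0U 1%g) -leadS // -leadS; last exact: (@JpowS 0).
rewrite raddfB !(raddfB (lmul g)) /= !lmulU !mulg1 !raddfB /= leadS1 /lead2.
rewrite opprK addr0 -[lead 2 _ - _ - _]addrA.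
by rewrite -opprD [RHS]addrC subrK.
Qed.
End GroupRing.
Arguments Jpow {r} n x : simpl never.
Arguments lead {r} n x : simpl never.

Section GroupRingNat.
Variables (s r : nat) (f : gr s r).
Local Notation fm := (fmap group_ring f).

Lemma fmap_lmul g x : fm (lmul g x) = lmul (f g) (fm x).
Proof.
apply: (freeg_additive_eq (f := fm \o lmul g) (g := lmul (f g) \o fm)) => h /=.
by rewrite lmulU !lin_mapU lmulU /elt_act gmulfM.
Qed.

Lemma fmap_Jpow n x : Jpow n x -> Jpow n (fm x).
Proof.
elim: n x => // n IHn; apply: JpowS_ind => [|x y Jx Jy|g y Jy].
- by rewrite raddf0; apply: Jpow0.
- by rewrite raddfB; apply: JpowB.
- by rewrite raddfB fmap_lmul; apply/JpowS/IHn.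
Qed.

Lemma fmap_dprod k g : fm (dprod k g) = dprod k (f \o g).
Proof.
elim: k g => [|k IHk] g; first by rewrite [LHS]lin_mapU /elt_act gmulf1.
by rewrite [dprod _ _]/= raddfB fmap_lmul !IHk.
Qed.

(** Fox derivatives depend on the basis, but on I^n the rule [leadS] determines the leading term and
    is natural. *)
Lemma lead_fmap n x : Jpow n x -> lead n (fm x) = tensor_map (ab_map f) (lead n x).
Proof.
elim: n x => [|n IHn].
  move=> x _; move: x.
  apply: (freeg_additive_eq (f := lead 0 \o fm)
    (g := tensor_map (ab_map f) \o lead 0)) => g.
  by rewrite /= lin_mapU !lead0U tensor_map_tpure [RHS]tpure0.
apply: JpowS_ind => [|x y Jx Jy|g y Jy]; first by rewrite !raddf0.
  by rewrite (raddfB fm) !leadB Jx Jy [RHS]raddfB.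
rewrite leadS // tensor_map_prepend [X in prepend X]/= ab_map_pi -IHn // -leadS;
  last exact: fmap_Jpow.
by rewrite raddfB fmap_lmul.
Qed.
End GroupRingNat.

(** * Polynomial quotients of the group ring *)

Section QuotientFunctor.
Variables (F : functor) (I : forall r, zmodClosed (F r)).
Hypothesis fmapI : forall s r (f : gr s r) x, x \in I s -> fmap F f x \in I r.

Definition quotient_pi r : {additive F r -> Quotient.quot (I r)} :=
  \pi_(Quotient.quot (I r)).

Lemma quotient_pi_surj r y : exists x, quotient_pi r x = y.
Proof. by exists (repr y); rewrite /quotient_pi /= reprK. Qed.

Lemma quotient_pi_eq0 r x : quotient_pi r x = 0 <-> x \in I r.
Proof. by rewrite -(raddf0 (quotient_pi r)) -quot_pi_eq subr0. Qed.

Lemma quotient_map_ker s r (f : gr s r) :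
  {in I s, forall x, (quotient_pi r \o fmap F f) x = 0}.
Proof. by move=> x Ix; apply/quotient_pi_eq0/fmapI. Qed.

Definition quotient_map s r (f : gr s r) :
    {additive Quotient.quot (I s) -> Quotient.quot (I r)} :=
  quot_lift (quotient_map_ker f).

Lemma quotient_mapE s r (f : gr s r) x :
  quotient_map f (quotient_pi s x) = quotient_pi r (fmap F f x).
Proof. exact: quot_lift_pi. Qed.

Lemma quotient_map_id r (x : Quotient.quot (I r)) : quotient_map (gr_id r) x = x.
Proof. by have [y <-] := quotient_pi_surj x; rewrite [LHS]quotient_mapE fmap_id. Qed.

Lemma quotient_map_comp r s t (g : gr s t) (f : gr r s) (x : Quotient.quot (I r)) :
  quotient_map (gr_comp g f) x = quotient_map g (quotient_map f x).
Proof.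
have [y <-] := quotient_pi_surj x.
by rewrite [LHS]quotient_mapE fmap_comp -quotient_mapE -quotient_mapE.
Qed.

Definition quotient_functor : functor :=
  @Functor (fun r => Quotient.quot (I r)) (fun s r f => quotient_map f)
    quotient_map_id quotient_map_comp.

Definition quotient_proj : nat_trans F quotient_functor :=
  @NatTrans F quotient_functor quotient_pi (fun s r f x => esym (quotient_mapE f x)).
End QuotientFunctor.

Definition Jpred n r : {pred group_ring r} := fun x => `[< Jpow n (x : ZG r) >].

Lemma Jpred_zmod_closed n r : zmod_closed (@Jpred n r).
Proof.
split=> [|x y]; first exact/asboolP/Jpow0.
by move=> /asboolP Jx /asboolP Jy; apply/asboolP/JpowB.
Qed.
HB.instance Definition _ n r :=
  GRing.isZmodClosed.Build (group_ring r) (@Jpred n r) (Jpred_zmod_closed n r).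

Lemma fmap_Jpred n s r (f : gr s r) x :
  x \in @Jpred n s -> fmap group_ring f x \in @Jpred n r.
Proof. by move=> /asboolP Jx; apply/asboolP/fmap_Jpow. Qed.

Definition group_ring_mod n : functor := quotient_functor (@fmap_Jpred n).

Definition mod_proj n : nat_trans group_ring (group_ring_mod n) :=
  quotient_proj (@fmap_Jpred n).

Lemma mod_proj_surj n r (y : group_ring_mod n r) : exists x, mod_proj n r x = y.
Proof. exact: quotient_pi_surj. Qed.

Lemma mod_proj_eq0 n r x : mod_proj n r x = 0 <-> Jpow n x.
Proof.
have [p0 ip] := @quotient_pi_eq0 group_ring (@Jpred n) r x.
by split=> [/p0/asboolP//|Jx]; apply/ip/asboolP.
Qed.

Section Kill.
Variables (R : nat) (I : eqType) (kappa : 'I_R -> I).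
Implicit Types (i : I) (s : seq I) (y : ZG R).

(** In the application the colour of a letter is the free factor that contains it. *)
Definition kill1 i : gr R R :=
  free_lift (fun a => if kappa a == i then 1%g else free_gen a).

Fixpoint kill s : ZG R -> ZG R :=
  if s is i :: s' then fun y => kill s' (y - fmap group_ring (kill1 i) y) else id.

Lemma kill_is_additive s : zmod_morphism (kill s).
Proof.
elim: s => //= i s IHs x y; rewrite -IHs; congr kill.
by rewrite raddfB opprD addrACA -opprD.
Qed.
HB.instance Definition _ s := GRing.isZmodMorphism.Build _ _ (kill s) (kill_is_additive s).

(** If x_a has colour i, then x_a y - [kill1 i] (x_a y) = (y - [kill1 i] y) + (x_a - 1) y; the other
    colours of [s] commute with x_a. *)
Lemma kill_lmul s a y : uniq s -> kill s (lmul (free_gen a) y) =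
  if kappa a \in s then
    kill s y +
      (lmul (free_gen a) (kill (rem (kappa a) s) y) - kill (rem (kappa a) s) y)
  else lmul (free_gen a) (kill s y).
Proof.
elim: s y => //= i s IHs y /andP[iNs Us].
rewrite fmap_lmul [kill1 i _]free_lift_gen in_cons [i == _]eq_sym.
case: eqP => [e|_] /=; last first.
  by rewrite -[_ - lmul _ _](raddfB (lmul (free_gen a))) IHs.
rewrite lmul1 ![kill s (_ - _)]raddfB /= IHs // e ifN //.
by rewrite [RHS]addrC addrA subrK.
Qed.

(* Each factor 1 - kill1 i commutes with the letters of other colours and replaces a
   letter x_a of colour i by x_a - 1. *)
Lemma Jpow_kill s y : uniq s -> Jpow (size s) (kill s y).
Proof.
move: {-2}(size s) (erefl (size s)) => k; elim: k s y => // k IHk s y sk Us.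
elim/freeg_ind: y => [|x y Jx Jy|g]; first by rewrite raddf0; apply: Jpow0.
  by rewrite raddfB; apply: JpowB.
elim/free_group_ind: g => [|a g IH|a g IH].
- case: s sk Us => //= i s _ _; rewrite lin_mapU /elt_act gmulf1 subrr raddf0.
  exact: Jpow0.
- rewrite -lmulU kill_lmul //; case: ifP => [as_|_]; last exact: Jpow_lmul.
  by apply: JpowD => //; apply/JpowS/IHk; rewrite ?rem_uniq // size_rem // -sk.
- rewrite -[g](mulVKg (free_gen a)) -lmulU in IH; move: (freeg_gen _) IH => z.
  rewrite kill_lmul // => IH.
  case: ifP IH => [as_|_]; last exact: Jpow_lmulE.
  set w := lmul _ _ - _ => Jw; rewrite -[kill _ _](addrK w).
  by apply: JpowB => //; apply/JpowS/IHk; rewrite ?rem_uniq // size_rem // -sk.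
Qed.

(** Under the first hypothesis [kill s y] and y agree modulo I^n. *)
Lemma kill_Jpow s n y : (forall i, Jpow n (fmap group_ring (kill1 i) y)) ->
  Jpow n (kill s y) -> Jpow n y.
Proof.
have JK t x : Jpow n x -> Jpow n (kill t x).
  elim: t x => //= i t IHt x Jx; apply/IHt/JpowB => //; exact: fmap_Jpow.
move=> Jy; elim: s => //= i s IHs; rewrite raddfB => Jk; apply: IHs.
by rewrite -[kill s y](subrK (kill s (fmap group_ring (kill1 i) y))); apply/JpowD/JK.
Qed.
End Kill.

(** A cross effect agrees modulo I^(n+1) with its image under [kill] for all n + 1 factors, and this
    image lies in I^(n+1) by [Jpow_kill]. *)
Lemma group_ring_mod_polynomial n : polynomial_functor n (group_ring_mod n.+1).
Proof.
move=> r_ x; have [y <-] := mod_proj_surj x => cy.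
have Jomit i : Jpow n.+1 (fmap group_ring (free_product_omit r_ i) y).
  by apply/mod_proj_eq0; rewrite nt_natural; apply: cy.
apply/mod_proj_eq0.
apply: (@kill_Jpow _ _ (@tagnat.sig1 _ r_) (enum 'I_n.+1)); last first.
  by have := Jpow_kill (@tagnat.sig1 _ r_) y (enum_uniq 'I_n.+1); rewrite size_enum_ord.
(* Killing the letters of factor i amounts to omitting that factor and including the others back. *)
move=> i; pose incl := free_product_lift (fun j => free_product_incl r_ (fintype.lift i j)).
suff -> : kill1 (@tagnat.sig1 _ r_) i = gr_comp incl (free_product_omit r_ i).
  by rewrite fmap_comp; apply: fmap_Jpow.
apply/group_hom_eq/free_hom_eq => q.
have [i' [k ->]] : exists i' (k : 'I_(r_ i')), q = tagnat.Rank i' k.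
  by exists (tagnat.sig1 q), (tagnat.sig2 q); rewrite tagnat.sig2K.
rewrite [LHS]free_lift_gen tagnat.Rank1K [RHS]/=.
case: (unliftP i i') k => [j ->|->] k; last first.
  by rewrite eqxx free_product_omit_self gmulf1.
rewrite eq_sym (negPf (neq_lift i j)) free_product_omit_incl.
rewrite [RHS]free_lift_gen /tagnat.sig1 /tagnat.sig2 tagnat.rankK /=.
by rewrite [RHS]free_lift_gen.
Qed.

(** * The functor [Pbar] as augmentation ideal, and diagonal tensors *)

Definition gr1 r (g : free_group r) : {classic (gr 1 r)} := free_lift (fun=> g).

Lemma gr1_gen r (g : free_group r) : (gr1 g : gr 1 r) (free_gen ord0) = g.
Proof. exact: free_lift_gen. Qed.

Lemma gr1_eq r (e f : gr 1 r) : e (free_gen ord0) = f (free_gen ord0) -> e = f.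
Proof. by move=> ef; apply/group_hom_eq/free_hom_eq => a; rewrite (ord1 a). Qed.

Lemma gr1_comp s r (f : gr s r) (g : free_group s) : gr1 (f g) = gr_comp f (gr1 g).
Proof. by apply: gr1_eq; rewrite [LHS]gr1_gen -[in LHS](gr1_gen g). Qed.

Definition eval1 r (f : {classic (gr 1 r)}) : group_ring r :=
  freeg_gen ((f : gr 1 r) (free_gen ord0)).

Lemma eval1_natural s r (f : gr s r) (g : {classic (gr 1 s)}) :
  eval1 (repr_act f g) = fmap group_ring f (eval1 g).
Proof. by rewrite [RHS]lin_mapU. Qed.

Definition repr_ev : nat_trans (repr_functor 1) group_ring :=
  lin_lift (@repr_act_id 1) (@repr_act_comp 1) eval1_natural.

Lemma repr_evU r (f : {classic (gr 1 r)}) :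
  repr_ev r (freeg_gen f) = eval1 f.
Proof. exact: freeg_liftU. Qed.

Definition Pbar_ev : nat_trans Pbar group_ring :=
  nt_comp repr_ev (kernel_incl (augmentation 1)).

(** The group ring modulo I^(n+1) is a polynomial target, so the kernel dies in it. *)
Lemma qn_ker_Jpow n r (x : Pbar r) : x \in @qn_ker n Pbar r -> Jpow n.+1 (Pbar_ev r x).
Proof.
move=> /asboolP /(_ _ (nt_comp (mod_proj n.+1) Pbar_ev)) x0.
exact/mod_proj_eq0/x0/group_ring_mod_polynomial.
Qed.

Lemma Pbar_elt_subproof r (g : free_group r) :
  freeg_gen (gr1 g) - freeg_gen (gr1 1%g) \in ker_pred (augmentation 1 r).
Proof. by apply/ker_predP; rewrite raddfB /= /aug /freeg_gen !degU subrr. Qed.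

Definition Pbar_elt r (g : free_group r) : Pbar r := Kernel (Pbar_elt_subproof g).

Lemma Pbar_evE r (g : free_group r) : Pbar_ev r (Pbar_elt g) = freeg_gen g - freeg_gen 1%g.
Proof. by rewrite /= raddfB !repr_evU /eval1 !gr1_gen. Qed.

(** Multiplying by a map of degree one raises the polynomial degree by at most one. The induction
    varies [psi]: a Leibniz formula replaces it by y |-> psi ((g - 1) y), which vanishes one power
    of I earlier. *)
Lemma prepend_diag_Jpow r n k
    (psi : {additive ZG r -> tensor_power n (abelianization (free_group r))}) :
  (forall y, Jpow k y -> psi y = 0) ->
  forall y, Jpow k.+1 y ->
    freeg_lift (fun h => prepend (abpi h) (psi (freeg_gen h))) y = 0.
Proof.
elim: k psi => [|k IHk] psi psi0.
  move=> y _; apply: (freeg_additive_eq (g := \0)) => h.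
  by rewrite [LHS]freeg_liftU psi0 // raddf0.
apply: JpowS_ind => [|x y x0 y0|g y Jy]; first exact: raddf0.
  by rewrite raddfB /= x0 y0 subrr.
pose psi' : {additive _ -> _} := (psi \o lmul g) \- psi.
have psi'0 z : Jpow k z -> psi' z = 0.
  by move=> Jz; rewrite /= -raddfB psi0 //; apply: JpowS.
have -> : freeg_lift (fun h => prepend (abpi h) (psi (freeg_gen h))) (lmul g y - y) =
    prepend (abpi g) (psi (lmul g y)) +
    freeg_lift (fun h => prepend (abpi h) (psi' (freeg_gen h))) y.
  rewrite raddfB; apply/eqP; rewrite subr_eq; apply/eqP; move: y {Jy}.
  pose L := freeg_lift (fun h => prepend (abpi h) (psi (freeg_gen h))).
  apply: (freeg_additive_eq (f := L \o lmul g)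
    (g := ((prepend (abpi g) \o (psi \o lmul g)) \+ freeg_lift _) \+ L)) => h.
  rewrite /= lmulU /L !freeg_liftU abpiM prependDl -addrA; congr (_ + _).
  by rewrite raddfB lmulU subrK.
by rewrite psi0 ?raddf0 ?add0r; [apply: IHk|apply: Jpow_lmul].
Qed.

Local Notation Tab n := (tensor_functor n ab_functor).

Definition diag_elt n r (g : free_group r) : Tab n r := tpure n (fun=> abpi g).

Lemma diag_natural n s r (f : gr s r) (g : free_group s) :
  diag_elt n (elt_act f g) = fmap (Tab n) f (diag_elt n g).
Proof.
rewrite [RHS]tensor_map_tpure; apply: eq_tpure => i _ /=.
by rewrite ab_map_pi.
Qed.

Definition diag n : nat_trans group_ring (Tab n) :=
  lin_lift elt_act_id elt_act_comp (@diag_natural n).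

Lemma diagU n r (g : free_group r) : diag n r (freeg_gen g) = tpure n (fun=> abpi g).
Proof. exact: freeg_liftU. Qed.

(** The map g |-> g (x) ... (x) g is a product of n maps of degree one. *)
Lemma diag_Jpow n r (x : ZG r) : Jpow n.+1 x -> diag n r x = 0.
Proof.
elim: n x => [|n IHn] x Jx.
  rewrite -(lead_eq0 Jx); move: x {Jx}.
  apply: (freeg_additive_eq (f := diag 0 r) (g := lead 0)) => g.
  by rewrite diagU [RHS]lead0U tpure0.
rewrite -(prepend_diag_Jpow IHn Jx); move: x {Jx}.
apply: (freeg_additive_eq (f := diag n.+1 r) (g := freeg_lift _)) => g.
by rewrite diagU [RHS]freeg_liftU diagU tpureS.
Qed.

Section QnDiag.
Variable n : nat.

(** Vanishing on I^(n+1) takes the place of a proof that the target is polynomial. *)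
Lemma qn_diag_ker r :
  {in @qn_ker n Pbar r, forall x, (diag n r \o Pbar_ev r) x = 0}.
Proof. by move=> x /qn_ker_Jpow /diag_Jpow. Qed.

Definition qn_diag_app r : {additive qn n Pbar r -> Tab n r} :=
  quot_lift (@qn_diag_ker r).

Lemma qn_diagE r x : qn_diag_app r (qn_unit n Pbar r x) = diag n r (Pbar_ev r x).
Proof. exact: quot_lift_pi. Qed.

Lemma qn_diag_natural s r (f : gr s r) (x : qn n Pbar s) :
  qn_diag_app r (fmap (qn n Pbar) f x) = fmap (Tab n) f (qn_diag_app s x).
Proof.
have [y <-] := qn_pi_surj x.
by rewrite -qn_unit_natural !qn_diagE !nt_natural.
Qed.

Definition qn_diag : nat_trans (qn n Pbar) (Tab n) := NatTrans qn_diag_natural.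
End QnDiag.

(** * Exponent sums, product and determinant forms *)

Section ExpSum.
Variables (r : nat) (a : 'I_r).
Implicit Types g h : free_group r.

Definition expsum_fun g : int := deg (fox a (freeg_gen g)).

Lemma expsum_fun_gen b g :
  expsum_fun (free_gen b * g)%g = (b == a)%:R + expsum_fun g.
Proof.
rewrite /expsum_fun -lmulU fox_lmul addrC raddfD; congr (_ + _).
by case: (b == a); rewrite ?raddf0 //; apply: degU.
Qed.

Lemma expsum_funM g h : expsum_fun (g * h)%g = expsum_fun g + expsum_fun h.
Proof.
elim/free_group_ind: g => [|b g IH|b g IH].
- by rewrite mul1g /expsum_fun fox1 raddf0 add0r.
- by rewrite -mulgA !expsum_fun_gen IH addrA.
- apply: (addrI (b == a)%:R); rewrite addrA -!expsum_fun_gen -mulgA mulVKg.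
  by rewrite mulVKg.
Qed.

(* The exponent sum of x_a. *)
Definition expsum : abelianization (free_group r) -> int := ab_lift expsum_funM.
HB.instance Definition _ := GRing.Additive.on expsum.

Lemma expsum_pi g : expsum (abpi g) = expsum_fun g.
Proof. exact: ab_lift_pi. Qed.

Lemma expsum_gen b : expsum (abpi (free_gen b)) = (b == a)%:R.
Proof.
rewrite expsum_pi -[free_gen b]mulg1 expsum_fun_gen /expsum_fun fox1 raddf0.
by rewrite addr0.
Qed.
End ExpSum.

(** The classes of the generators form a basis, with the exponent sums as coordinates. *)
Lemma abpi_expsum r (V : zmodType) (f : {additive abelianization (free_group r) -> V}) x :
  f x = \sum_a f (abpi (free_gen a)) *~ expsum a x.
Proof.
pose h x := \sum_a f (abpi (free_gen a)) *~ expsum a x.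
have hB : zmod_morphism h.
  by move=> y z; rewrite -sumrB; apply: eq_bigr => a _; rewrite raddfB mulrzBr.
pose hA := GRing.isZmodMorphism.Build _ _ h hB.
pose H : {additive _ -> _} := HB.pack h hA.
apply: (ab_additive_eq (g := H)) => b /=; rewrite /h (bigD1 b) //= expsum_gen eqxx.
rewrite mulr1z big1 ?addr0 // => a ab.
by rewrite expsum_gen eq_sym (negPf ab) mulr0z.
Qed.

Section Functionals.
Variables (m r : nat).
Local Notation V := (abelianization (free_group r)).

Definition prod_fun (a : 'I_r) (t : {ffun 'I_m -> V}) : int := \prod_i expsum a (t i).

Lemma prod_fun_multiadditive a : multiadditive (prod_fun a).
Proof.
move=> i t t1 t2 ti tj.
have prodE u : prod_fun a u = expsum a (u i) * \prod_(j | j != i) expsum a (u j).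
  by rewrite /prod_fun (bigD1 i).
rewrite !prodE ti raddfD mulrDl.
by congr (_ * _ + _ * _); apply: eq_bigr => j /tj[tj1 tj2]; rewrite -?tj1 -?tj2.
Qed.

Definition prod_form a : tensor_power m V -> int := tensor_lift (@prod_fun_multiadditive a).
HB.instance Definition _ a := GRing.Additive.on (prod_form a).

Lemma prod_form_tpure a v : prod_form a (tpure m v) = \prod_(i < m) expsum a (v i).
Proof. by rewrite [LHS]tensor_liftE; apply: eq_bigr => i _; rewrite ffunE. Qed.
End Functionals.

Section DetForm.
Variable m : nat.
Local Notation V := (abelianization (free_group m)).

Definition det_fun (t : {ffun 'I_m -> V}) : int :=
  \det (\matrix_(i < m, j < m) expsum j (t i)).

Lemma det_fun_multiadditive : multiadditive det_fun.
Proof.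
move=> i t t1 t2 ti tj; rewrite /det_fun -[X in X + _]mul1r -[X in _ + X]mul1r.
have tl k : fintype.lift i k != i by rewrite eq_sym neq_lift.
apply: (@determinant_multilinear _ _ _ _ _ i).
- by apply/rowP => j; rewrite !mxE !mul1r ti raddfD.
- by apply/matrixP => k j; rewrite !mxE; have [<- _] := tj _ (tl k).
- by apply/matrixP => k j; rewrite !mxE; have [_ <-] := tj _ (tl k).
Qed.

Definition det_form : tensor_power m V -> int := tensor_lift det_fun_multiadditive.
HB.instance Definition _ := GRing.Additive.on det_form.

Lemma det_form_gen : det_form (tpure m (fun i => abpi (gen m i))) = 1.
Proof.
rewrite [LHS]tensor_liftE /det_fun -[RHS](det1 _ m); congr (\det _).
by apply/matrixP => i j; rewrite !mxE ffunE gen_ord expsum_gen.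
Qed.

(** The product has rank at most s < m; ranks are compared over the rationals. *)
Lemma det_mulmx_lt s (A : 'M[int]_(m, s)) (B : 'M[int]_(s, m)) :
  (s < m)%N -> \det (A *m B) = 0.
Proof.
move=> sm; apply/eqP; rewrite -(intr_eq0 rat) -det_map_mx map_mxM.
apply: contraLR sm; rewrite -unitfE -unitmxE -row_free_unit => /eqP rk.
rewrite -leqNgt -rk; apply: leq_trans (mxrankM_maxl _ _) (rank_leq_col _).
Qed.

(** The matrix of exponent sums factors through the s generators of the source. *)
Lemma det_form_low s (f : gr s m) (x : Tab m s) :
  (s < m)%N -> det_form (fmap (Tab m) f x) = 0.
Proof.
move=> sm.
apply: (tensor_power_additive_eq (f := det_form \o tensor_map (ab_map f)) (g := \0)) => t.
rewrite /= tensor_mapE [LHS]tensor_liftE /det_fun.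
rewrite (_ : \matrix_(i, j) _ = (\matrix_(i, a) expsum a (t i)) *m
  (\matrix_(a, j) expsum j (ab_map f (abpi (free_gen a))))); first exact: det_mulmx_lt.
apply/matrixP => i j; rewrite !mxE ffunE.
rewrite [LHS](abpi_expsum (expsum j \o ab_map f)); apply: eq_bigr => a _.
by rewrite !mxE mulrzz mulrC.
Qed.
End DetForm.

(** * Bar differentials and quadratic terms *)

(* The faces of the bar construction on the letters g b, g (b + 1), ...; the letters
   before g b are left alone. Face b omits g b, face i multiplies g (i - 1) with g i. *)
Definition face_fun b (G : groupType) i (g : nat -> G) (a : nat) : G :=
  if (a.+1 < i)%N then g a
  else if a.+1 == i then if i == b then g a else (g a * g a.+1)%g
  else g a.+1.

Lemma face_fun_morph b (G H : groupType) (f : group_hom G H) i (g : nat -> G) a :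
  f (face_fun b i g a) = face_fun b i (f \o g) a.
Proof. by rewrite /face_fun; do 3?[case: ifP => // _]; rewrite gmulfM. Qed.

(** These are the simplicial identities; associativity enters when two adjacent products meet. *)
Lemma face_funC b (G : groupType) i j (g : nat -> G) a : (b <= i < j)%N ->
  face_fun b i (face_fun b j g) a = face_fun b j.-1 (face_fun b i g) a.
Proof.
move=> bij; rewrite /face_fun.
by do 20?[case: ifP => //]; rewrite ?mulgA //; lia.
Qed.

Lemma eq_face_fun b (G : groupType) i (g h : nat -> G) n a : (a.+1 < n)%N ->
  (forall c, (c < n)%N -> g c = h c) -> face_fun b i g a = face_fun b i h a.
Proof.
move=> an gh; rewrite /face_fun; do 3?[case: ifP => // _];
by rewrite !gh //; apply: ltnW.
Qed.

(** A face raises the rank: the letters of the smaller group go to a face of the generic tuple of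
    the larger one. *)
Definition face b N i : gr N N.+1 := subst N (face_fun b i (gen N.+1)).

Lemma face_gen b N i a : (a < N)%N -> face b N i (gen N a) = face_fun b i (gen N.+1) a.
Proof. exact: subst_gen. Qed.

Lemma gr_eq_gen N s (e f : gr N s) :
  (forall a, (a < N)%N -> e (gen N a) = f (gen N a)) -> e = f.
Proof.
by move=> ef; apply/group_hom_eq/free_hom_eq => a; rewrite -!gen_ord; apply: ef.
Qed.

Lemma face_comp b N i j : (b <= i < j)%N ->
  gr_comp (face b N.+1 j) (face b N i) = gr_comp (face b N.+1 i) (face b N j.-1).
Proof.
move=> bij; apply: gr_eq_gen => a aN; rewrite /= !face_gen // !face_fun_morph.
transitivity (face_fun b i (face_fun b j (gen N.+2)) a).
  by apply: (@eq_face_fun _ _ _ _ _ N.+1) => // c cN; rewrite /= face_gen.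
rewrite face_funC //; apply: (@eq_face_fun _ _ _ _ _ N.+1) => // c cN.
by rewrite /= face_gen.
Qed.

Lemma alternating_square (V : zmodType) (A : nat -> nat -> V) b n :
  (forall i j, (b <= i < j)%N -> A j i = A i j.-1) ->
  \sum_(b <= j < n.+1) \sum_(b <= i < n) A j i *~ (-1) ^+ i *~ (-1) ^+ j = 0.
Proof.
move=> AC; have [nb|bn] := ltnP n b.
  by rewrite big_geq // (leq_trans nb).
rewrite -(subnK bn); elim: (n - b)%N => [|k IHk].
  by rewrite add0n big1 // => j _; rewrite big_geq.
rewrite addSn; set N := (k + b)%N in IHk *; have bN : (b <= N)%N by apply: leq_addl.
(* Raising the bound adds the row j = N + 1 and the column i = N, whose terms cancel in pairs by
   [AC]. *)
rewrite big_nat_recr /=; last exact: leqW.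
rewrite (eq_bigr (fun j => \sum_(b <= i < N) A j i *~ (-1) ^+ i *~ (-1) ^+ j +
  A j N *~ (-1) ^+ N *~ (-1) ^+ j)); last by move=> j _; rewrite big_nat_recr.
rewrite big_split /= IHk add0r -big_split /= big_nat_cond big1 // => i.
rewrite andbT => /andP[bi iN]; rewrite (AC i N.+1) ?bi //= -!mulrzA -mulrzDr.
by rewrite exprS mulN1r mulrN [_ ^+ i * _]mulrC subrr mulr0z.
Qed.

Section Boundary.
Variables (b : nat) (F : functor) (N : nat).

Definition bd (x : F N) : F N.+1 :=
  \sum_(b <= i < N.+2) fmap F (face b N i) x *~ (-1) ^+ i.

Lemma bd_is_additive : zmod_morphism bd.
Proof.
by move=> x y; rewrite -sumrB; apply: eq_bigr => i _; rewrite raddfB mulrzBl.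
Qed.
HB.instance Definition _ := GRing.isZmodMorphism.Build (F N) (F N.+1) bd bd_is_additive.
End Boundary.

Lemma bd_bd b (F : functor) N (x : F N) : bd b (bd b x) = 0.
Proof.
rewrite -(@alternating_square _ (fun j i => fmap F (face b N.+1 j) (fmap F (face b N i) x))
  b N.+2).
  apply: eq_bigr => j _; rewrite raddf_sum mulrz_suml.
  by apply: eq_bigr => i _; rewrite raddfMz.
by move=> i j bij; rewrite -!fmap_comp face_comp.
Qed.

Lemma bd_natural b (F G : functor) (p : nat_trans F G) N (x : F N) :
  p N.+1 (bd b x) = bd b (p N x).
Proof.
by rewrite raddf_sum; apply: eq_bigr => i _; rewrite raddfMz nt_natural.
Qed.

(** Every face comes from rank N < N + 1. *)
Lemma det_form_bd b N (x : Tab N.+1 N) : det_form (bd b x) = 0.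
Proof.
rewrite raddf_sum big1 // => i _; rewrite raddfMz /=.
by rewrite [det_form _]det_form_low // mul0rz.
Qed.

Definition tup_act s r (f : gr s r) (g : {classic (nat -> free_group s)}) :
  {classic (nat -> free_group r)} := fun a => f (g a).

Lemma tup_act_id r (g : {classic (nat -> free_group r)}) : tup_act (gr_id r) g = g.
Proof. by []. Qed.

Lemma tup_act_comp r s t (g : gr s t) (f : gr r s) (x : {classic (nat -> free_group r)}) :
  tup_act (gr_comp g f) x = tup_act g (tup_act f x).
Proof. by []. Qed.

(** With infinite sequences a single functor covers all tensor powers; [pure N] reads the first N
    terms. *)
Definition tuples : functor := linearization tup_act_id tup_act_comp.

Definition tup_pure N r (g : {classic (nat -> free_group r)}) : Tab N r :=
  tpure N (fun a => abpi ((g : nat -> free_group r) a)).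

Lemma tup_pure_natural N s r (f : gr s r) (g : {classic (nat -> free_group s)}) :
  tup_pure N (tup_act f g) = fmap (Tab N) f (tup_pure N g).
Proof.
rewrite [RHS]tensor_map_tpure; apply: eq_tpure => i _ /=.
by rewrite ab_map_pi.
Qed.

Definition pure N : nat_trans tuples (Tab N) :=
  lin_lift tup_act_id tup_act_comp (@tup_pure_natural N).

Lemma pureU N r (g : {classic (nat -> free_group r)}) :
  pure N r (freeg_gen g) = tup_pure N g.
Proof. exact: freeg_liftU. Qed.

Lemma pure_surj N r (y : Tab N r) : exists x, pure N r x = y.
Proof.
pose tup (t : {ffun 'I_N -> abelianization (free_group r)}) :
    {classic (nat -> free_group r)} :=
  fun a => if insub a is Some i then repr (t i) else 1%g.
exists (freeg_lift (fun t => freeg_gen (tup t)) (repr y)).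
rewrite -[RHS]reprK; apply: (freeg_additive_eq (f := pure N r \o freeg_lift _)
  (g := \pi_(Quotient.quot (span_pred (@tensor_rel N (abelianization (free_group r)))))))
  => t.
rewrite /= [X in freeg_lift _ X]freeg_liftU [LHS]freeg_liftU.
by congr tensor; apply/ffunP => i; rewrite ffunE /tup valK reprK.
Qed.

Section Mu.
Variable r : nat.
Implicit Types g h : nat -> free_group r.

(* The last letter is replaced by its quadratic Magnus term. *)
Fixpoint mu_fun p g : tensor_power p.+2 (abelianization (free_group r)) :=
  if p is p'.+1 then prepend (abpi (g 0%N)) (mu_fun p' (g \o succn))
  else lead2 (g 0%N).

Lemma eq_mu_fun p g h : (forall a, (a <= p)%N -> g a = h a) -> mu_fun p g = mu_fun p h.
Proof.
elim: p g h => [|p IHp] g h gh /=; rewrite (gh 0%N) //.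
by congr prepend; apply: IHp => a ap; apply: gh.
Qed.

Lemma mu_funM p i g g1 g2 : (i < p)%N -> g i = (g1 i * g2 i)%g ->
  (forall a, (a <= p)%N -> a != i -> g a = g1 a /\ g a = g2 a) ->
  mu_fun p g = mu_fun p g1 + mu_fun p g2.
Proof.
elim: p i g g1 g2 => // p IHp [|i] g g1 g2 ip gi gE /=.
  rewrite gi abpiM prependDl; congr (prepend _ _ + prepend _ _).
    by apply: eq_mu_fun => a ap; case: (gE a.+1).
  by apply: eq_mu_fun => a ap; case: (gE a.+1).
have [<- <-] := gE 0%N isT isT.
by rewrite (IHp i _ (g1 \o succn) (g2 \o succn)) ?raddfD // => a ap ai; apply: gE.
Qed.

(** The last letter enters through [lead2], which deviates from additivity by a tensor product. *)
Lemma mu_fun_last p g g1 g2 : g p = (g1 p * g2 p)%g ->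
  (forall a, (a < p)%N -> g a = g1 a /\ g a = g2 a) ->
  mu_fun p g = mu_fun p g1 + mu_fun p g2 +
    tpure p.+2 (fun a => if (a <= p)%N then abpi (g1 a) else abpi (g2 p)).
Proof.
elim: p g g1 g2 => [|p IHp] g g1 g2 gp gE.
  by rewrite /= gp lead2M !tpureS tpure0.
rewrite [mu_fun _ g]/= (IHp _ (g1 \o succn) (g2 \o succn)) // => [|a ap]; last exact: gE.
have [g01 g02] := gE 0%N isT; rewrite !raddfD [in RHS]tpureS /= -g02.
by rewrite g01.
Qed.

Definition omit i g a := if (a < i)%N then g a else g a.+1.

(** For b < i <= p face i multiplies at a position where [mu_fun] is additive, so the sum telescopes
    through tuples with one letter omitted. Face p + 1 multiplies at the last position and leaves
    the quadratic deviation; face p + 2 cancels the rest. *)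
Lemma mu_fun_face b p g : (b <= p)%N ->
  \sum_(b <= i < p.+3) mu_fun p (face_fun b i g) *~ (-1) ^+ i =
  tpure p.+2 (fun a => abpi (g a)) *~ (-1) ^+ p.+1.
Proof.
move=> bp; pose u i := mu_fun p (omit i g) *~ (-1) ^+ i.
have partial k : (b <= k <= p)%N ->
    \sum_(b <= i < k.+1) mu_fun p (face_fun b i g) *~ (-1) ^+ i = u k.
  elim: k => [|k IHk] /andP[bk kp].
    move: bk; rewrite leqn0 => /eqP ->; rewrite big_nat1 /u; congr (_ *~ _).
  move: bk; rewrite leq_eqVlt => /orP[/eqP ->|bk].
    rewrite big_nat1 /u; congr (_ *~ _); apply: eq_mu_fun => a _.
    by rewrite /face_fun /omit eqxx; do 3?[case: ifP => //]; lia.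
  rewrite big_nat_recr; last exact: ltnW.
  rewrite -[LHS]/(_ + _) IHk; last by rewrite -ltnS bk ltnW.
  rewrite /u (@mu_funM p k (face_fun b k.+1 g) (omit k.+1 g) (omit k g)) //.
  - by rewrite exprS mulN1r !mulrNz mulrzDl opprD addrCA subrr addr0.
  - by rewrite /face_fun /omit !ltnn eqxx ltnSn gtn_eqF.
  - by move=> a ap ak; rewrite /face_fun /omit; split; do 3?[case: ifP => //]; lia.
rewrite big_nat_recr; last by lia.
rewrite big_nat_recr; last by lia.
rewrite -[LHS]/(_ + _ + _).
rewrite partial; last by rewrite bp leqnn.
rewrite (@mu_fun_last p (face_fun b p.+1 g) (omit p.+1 g) (omit p g)); first last.
- by move=> a ap; rewrite /face_fun /omit; split; do 3?[case: ifP => //]; lia.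
- by rewrite /face_fun /omit !ltnn eqxx ltnSn gtn_eqF.
rewrite (@eq_mu_fun p (face_fun b p.+2 g) (omit p.+1 g)); last first.
  by move=> a ap; rewrite /face_fun /omit; do 3?[case: ifP => //]; lia.
rewrite (@eq_tpure _ _ _ (fun a => abpi (g a))); last first.
  by move=> a ap; rewrite /omit; do 2?[case: ifP => //]; move=> *; congr (abpi (g _)); lia.
rewrite /u (exprS _ p.+1) !(exprS _ p) !mulN1r opprK !mulrNz !mulrzDl !opprD.
by rewrite addrAC addrA [X in X + _ + _]addrC -opprD subrr add0r.
Qed.
End Mu.

Definition mu p r : tuples r -> Tab p.+2 r :=
  freeg_lift (fun g : {classic (nat -> free_group r)} => mu_fun p g : Tab p.+2 r).
HB.instance Definition _ p r := GRing.Additive.on (@mu p r).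

Lemma muU p r (g : {classic (nat -> free_group r)}) : mu p (freeg_gen g) = mu_fun p g.
Proof. exact: freeg_liftU. Qed.

Lemma mu_bd b p (g := gen p.+1 : {classic (nat -> free_group p.+1)}) : (b <= p)%N ->
  mu p (bd b (freeg_gen g : tuples p.+1)) =
    tpure p.+2 (fun a => abpi (gen p.+2 a)) *~ (-1) ^+ p.+1.
Proof.
move=> bp; rewrite -(mu_fun_face _ bp) raddf_sum; apply: eq_bigr => i _.
rewrite raddfMz /=; congr (_ *~ _); rewrite lin_mapU muU; apply: eq_mu_fun => a ap.
exact: face_gen.
Qed.

Section MuNatural.
Variables (s r : nat) (f : gr s r).
Local Notation Vs := (abelianization (free_group s)).
Local Notation Vr := (abelianization (free_group r)).

Definition lead2_defect_fun (g : free_group s) : tensor_power 2 Vr :=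
  lead2 (f g) - tensor_map (ab_map f) (lead2 g).

(** Both terms deviate from additivity by f(g) (x) f(h), so their difference is additive. *)
Lemma lead2_defect_funM g h :
  lead2_defect_fun (g * h)%g = lead2_defect_fun g + lead2_defect_fun h.
Proof.
rewrite /lead2_defect_fun gmulfM !lead2M !raddfD /= !tensor_map_prepend /= !ab_map_pi.
rewrite tensor_map_tpure tpure0 -/(one_tensor _).
by rewrite addrACA subrr addr0 addrACA.
Qed.

(* The failure of naturality of [mu] only depends on the elementary tensor of the
   classes of the letters, hence vanishes on the kernel of [pure]. *)
Definition lead2_defect : Vs -> tensor_power 2 Vr := ab_lift lead2_defect_funM.
HB.instance Definition _ := GRing.Additive.on lead2_defect.

Fixpoint defect_fun p (v : nat -> Vs) : tensor_power p.+2 Vr :=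
  if p is p'.+1 then prepend (ab_map f (v 0%N)) (defect_fun p' (v \o succn))
  else lead2_defect (v 0%N).

Lemma defect_funP p (g : nat -> free_group s) :
  defect_fun p (fun a => abpi (g a)) =
    mu_fun p (fun a => f (g a)) - tensor_map (ab_map f) (mu_fun p g).
Proof.
elim: p g => [|p IHp] g /=; first by rewrite [LHS]ab_lift_pi.
by rewrite IHp tensor_map_prepend /= raddfB ab_map_pi.
Qed.

Lemma eq_defect_fun p v w : (forall a, (a <= p)%N -> v a = w a) ->
  defect_fun p v = defect_fun p w.
Proof.
elim: p v w => [|p IHp] v w vw /=; rewrite (vw 0%N) //.
by congr prepend; apply: IHp => a ap; apply: vw.
Qed.

Lemma defect_funD p i v v1 v2 : (i <= p)%N -> v i = v1 i + v2 i ->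
  (forall a, (a <= p)%N -> a != i -> v a = v1 a /\ v a = v2 a) ->
  defect_fun p v = defect_fun p v1 + defect_fun p v2.
Proof.
elim: p i v v1 v2 => [|p IHp] [|i] v v1 v2 ip vi vE //=.
- by rewrite vi raddfD.
- rewrite vi raddfD prependDl; congr (prepend _ _ + prepend _ _).
    by apply: eq_defect_fun => a ap; case: (vE a.+1).
  by apply: eq_defect_fun => a ap; case: (vE a.+1).
have [<- <-] := vE 0%N isT isT.
by rewrite (IHp i _ (v1 \o succn) (v2 \o succn)) ?raddfD // => a ap ai; apply: vE.
Qed.

Definition extend p (t : {ffun 'I_p -> Vs}) (a : nat) : Vs :=
  if insub a is Some i then t i else 0.

Lemma extend_ord p (t : {ffun 'I_p -> Vs}) (i : 'I_p) : extend t i = t i.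
Proof. by rewrite /extend valK. Qed.

Lemma defect_multiadditive p :
  multiadditive (fun t : {ffun 'I_p.+1 -> Vs} => defect_fun p (extend t)).
Proof.
move=> i t t1 t2 ti tj; apply: (@defect_funD _ i); rewrite ?extend_ord //.
  by rewrite -ltnS.
move=> a ap ai; rewrite -[a]/(val (Ordinal (ap : (a < p.+1)%N))) !extend_ord.
exact: tj.
Qed.

Definition defect p : tensor_power p.+1 Vs -> tensor_power p.+2 Vr :=
  tensor_lift (@defect_multiadditive p).
HB.instance Definition _ p := GRing.Additive.on (@defect p).

Lemma defect_tpure p v : defect (tpure p.+1 v) = defect_fun p v.
Proof.
rewrite [LHS]tensor_liftE; apply: eq_defect_fun => a ap.
by rewrite -[a]/(val (Ordinal (ap : (a < p.+1)%N))) extend_ord ffunE.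
Qed.

(** For every x the two sides differ by [defect] of [pure p.+1 s x]. *)
Lemma mu_natural p (x : tuples s) : pure p.+1 s x = 0 ->
  mu p (fmap tuples f x) = fmap (Tab p.+2) f (mu p x).
Proof.
move=> x0; apply/eqP; rewrite -subr_eq0; apply/eqP.
rewrite -[RHS](raddf0 (@defect p)) -x0 => {x0}; move: x.
apply: (freeg_additive_eq (f := (@mu p r \o fmap tuples f) \- (fmap (Tab p.+2) f \o @mu p s))
  (g := @defect p \o pure p.+1 s)) => g.
rewrite /= lin_mapU !muU [X in defect X]pureU [RHS]defect_tpure defect_funP.
by congr (_ - _).
Qed.
End MuNatural.

(** The case b = 0 of the next lemma: a, b, c, d, e, f, o stand for g1 g2, g1, g2, g0 g1 g2, g0 g1,
    g0, 1. *)
Lemma bar_cancel (V : zmodType) (a b c d e f o : V) :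
  (a - b - (c - o)) - (d - e - (c - o)) + (d - f - (a - o)) - (e - f - (b - o)) = 0.
Proof.
have subrKK (x y z : V) : (x - z) - (y - z) = x - y by rewrite opprB addrA subrK.
have subrACA (x y z t : V) : x - y - (z - t) = x - z - (y - t).
  by rewrite !opprD !opprK addrACA.
by rewrite subrKK -addrA [X in _ + X]subrACA !subrKK -[X in _ + X]opprB subrr.
Qed.

(** The first b factors are untouched by the faces and can be pulled out. What remains is the
    cocycle identity for (g - 1)(h - 1), up to sign the bar coboundary of g - 1. *)
Lemma bd_dprod_face b r (g : nat -> free_group r) :
  \sum_(b <= i < b.+4) dprod b.+2 (face_fun b i g) *~ (-1) ^+ i = 0.
Proof.
elim: b g => [|b IHb] g.
  have dprod2 (h : nat -> free_group r) : dprod 2 h =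
      freeg_gen (h 0 * h 1%N)%g - freeg_gen (h 0) - (freeg_gen (h 1%N) - freeg_gen 1%g).
    by rewrite /= !raddfB /= !lmulU !mulg1.
  rewrite (eq_bigr _ (fun i _ => congr2 _ (dprod2 (face_fun 0 i g)) erefl)).
  rewrite !big_nat_recr //= big_geq // add0r /face_fun /= mulgA.
  rewrite (_ : (-1) ^+ 3 = -1 :> int) //.
  by rewrite expr0 expr1 sqrrN expr1n !mulr1z !mulrN1z bar_cancel.
rewrite big_add1 /=.
pose S : ZG r :=
  \sum_(b <= i < b.+4) dprod b.+2 (face_fun b i (g \o succn)) *~ (-1) ^+ i.
transitivity (- (lmul (g 0%N) S - S)).
  rewrite raddf_sum -sumrB -sumrN; apply: eq_big_nat => i /andP[bi _].
  rewrite raddfMz -mulrzBl exprS mulN1r mulrNz; congr (- (_ *~ _)).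
  have tail : dprod b.+2 (face_fun b.+1 i.+1 g \o succn) =
      dprod b.+2 (face_fun b i (g \o succn)).
    by apply: eq_dprod => a _; rewrite /face_fun /= ltnS !eqSS.
  (* If i = 0 then b = 0, and the face is the omitting one, which keeps letter 0. *)
  have head : face_fun b.+1 i.+1 g 0 = g 0%N.
    rewrite /face_fun ltnS !eqSS; case: ltnP => //; rewrite leqn0 => /eqP i0.
    by move: bi; rewrite i0 leqn0 => /eqP ->.
  rewrite -[LHS]/(lmul (face_fun b.+1 i.+1 g 0)
      (dprod b.+2 (face_fun b.+1 i.+1 g \o succn))
    - dprod b.+2 (face_fun b.+1 i.+1 g \o succn)).
  by rewrite tail head.
by rewrite /S IHb raddf0 subrr oppr0.
Qed.

(** * Nonzero classes *)

Section Yoneda.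
Variables (F : functor) (y : F 1%N).

Definition yoneda_elt r (g : free_group r) : F r := fmap F (gr1 g : gr 1 r) y.

Lemma yoneda_natural s r (f : gr s r) (g : free_group s) :
  yoneda_elt (elt_act f g) = fmap F f (yoneda_elt g).
Proof. by rewrite /yoneda_elt gr1_comp fmap_comp. Qed.

Definition yoneda : nat_trans group_ring F :=
  lin_lift elt_act_id elt_act_comp yoneda_natural.

Lemma yonedaU r (g : free_group r) : yoneda r (freeg_gen g) = yoneda_elt g.
Proof. exact: freeg_liftU. Qed.
End Yoneda.

Lemma yoneda_comp (F G : functor) (p : nat_trans F G) (y : F 1%N) r (x : ZG r) :
  p r (yoneda y r x) = yoneda (p 1%N y) r x.
Proof.
move: x; apply: (freeg_additive_eq (f := p r \o yoneda y r) (g := yoneda (p 1%N y) r)).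
by move=> g /=; rewrite [in LHS]yonedaU yonedaU nt_natural.
Qed.

Lemma yonedaD (F : functor) (y z : F 1%N) r (x : ZG r) :
  yoneda (y + z) r x = yoneda y r x + yoneda z r x.
Proof.
move: x; apply: (freeg_additive_eq (f := yoneda (y + z) r)
  (g := yoneda y r \+ yoneda z r)) => g.
rewrite -[RHS]/(yoneda y r (freeg_gen g) + yoneda z r (freeg_gen g)) !yonedaU.
exact: raddfD.
Qed.

Local Notation x0 := (free_gen (ord0 : 'I_1)).

Lemma fmap_group_ringU s r (f : gr s r) (g : free_group s) :
  fmap group_ring f (freeg_gen g) = freeg_gen (f g).
Proof. exact: lin_mapU. Qed.

(** The endomorphism attached to [x0] - 1 subtracts the augmentation, hence is the identity on I. *)
Lemma yoneda_reduced r (x : ZG r) : Jpow 1 x ->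
  yoneda (freeg_gen x0 - freeg_gen 1%g : group_ring 1) r x = x.
Proof.
have E z : yoneda (freeg_gen x0 - freeg_gen 1%g : group_ring 1) r z =
    z - freeg_lift (fun=> freeg_gen 1%g) z.
  pose f : {additive ZG r -> ZG r} := yoneda (freeg_gen x0 - freeg_gen 1%g : group_ring 1) r.
  pose h : {additive ZG r -> ZG r} := freeg_lift (fun=> freeg_gen 1%g).
  apply: (freeg_additive_eq (f := f) (g := idfun \- h)) => g /=.
  apply: etrans (freeg_liftU _ _) _; rewrite /yoneda_elt raddfB.
  rewrite !fmap_group_ringU [X in _ - X]freeg_liftU gmulf1.
  by rewrite gr1_gen.
move: x; apply: JpowS_ind => [|x y ex ey|g y _].
- by rewrite raddf0.
- by rewrite raddfB /= ex ey.
rewrite E raddfB (_ : _ (lmul g y) = freeg_lift (fun=> freeg_gen 1%g) y) ?subrr ?subr0 //.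
move: y; apply: (freeg_additive_eq (f := freeg_lift _ \o lmul g) (g := freeg_lift _)) => h.
by rewrite /= lmulU !freeg_liftU.
Qed.

Definition univ_dprod n : ZG n.+1 := dprod n.+1 (gen n.+1).

(** The product of the n + 1 differences dies when any of n + 1 factors of rank one is omitted, so
    it gives a cross effect. *)
Lemma polynomial_yoneda n (F : functor) (y : F 1%N) : polynomial_functor n F ->
  yoneda y n.+1 (univ_dprod n) = 0.
Proof.
move=> pF; pose r_ (i : 'I_n.+1) := 1%N.
pose g a : free_group (\sum_i r_ i)%N := free_gen (@tagnat.Rank _ r_ (inord a) ord0).
have g0 : yoneda y _ (dprod n.+1 g) = 0.
  apply: pF => i; rewrite -nt_natural fmap_dprod (@dprod_eq0 _ _ _ i) ?raddf0 //.
  by rewrite /= /g inord_val free_product_omit_self.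
(* This passes from the rank written as a sum of ones to rank n + 1. *)
pose f : gr (\sum_i r_ i)%N n.+1 := free_lift (fun q => free_gen (tagnat.sig1 q)).
rewrite -(raddf0 (fmap F f)) -g0 -nt_natural fmap_dprod; congr (yoneda y _ _).
apply: eq_dprod => a an; rewrite /= [RHS]free_lift_gen tagnat.Rank1K.
by rewrite -gen_ord inordK.
Qed.

Lemma bd_univ_dprod b : bd (F := group_ring) b (univ_dprod b.+1) = 0.
Proof.
rewrite -[RHS](bd_dprod_face b (gen b.+3)); apply: eq_bigr => i _.
rewrite fmap_dprod; congr (_ *~ _); apply: eq_dprod => a ab.
exact: face_gen.
Qed.

Section Step.
Variables (A B G E G' : functor) (d : nat_trans B A) (c : nat_trans A G).
Variables (p : nat_trans E G) (m : forall r, {additive E r -> G' r}).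
Hypotheses (projA : projective_functor A) (cd : forall r y, c r (d r y) = 0).
Hypothesis p_surj : forall r y, exists x, p r x = y.
Hypothesis m_natural : forall s r (f : gr s r) (x : E s), p s x = 0 ->
  m r (fmap E f x) = fmap G' f (m s x).

(* The Yoneda product with the extension of G by G' obtained by pushing
   0 -> ker p -> E -> G -> 0 out along m. *)
Lemma connecting : exists (ct : nat_trans A E) (c' : nat_trans B G'),
  (forall r x, p r (ct r x) = c r x) /\ (forall r y, c' r y = m r (ct r (d r y))).
Proof.
have [ct ctE] := projA p_surj c.
have pct r x : p r (ct r x) = c r x by rewrite -ctE.
pose app r : {additive B r -> G' r} := m r \o (ct r \o d r).
have app_nat s r (f : gr s r) (x : B s) : app r (fmap B f x) = fmap G' f (app s x).
  by rewrite /= !nt_natural m_natural // pct cd.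
by exists ct, (NatTrans app_nat).
Qed.
End Step.

(** The values come from rank 1 < n + 1. *)
Lemma det_form_yoneda n (hn : (0 < n)%N) (y : Tab n.+1 1) (x : ZG n.+1) :
  det_form (yoneda y n.+1 x) = 0.
Proof.
apply: (freeg_additive_eq (f := @det_form n.+1 \o yoneda y n.+1) (g := \0)) => g.
by rewrite -[LHS]/(det_form (yoneda y _ (freeg_gen g))) yonedaU [LHS]det_form_low.
Qed.

Section NonzeroClass.
Variables (b : nat) (P : proj_resolution (qn b.+1 Pbar)).
Local Notation n := b.+1.

(** Induction hypothesis for Ext^(k+1) at m = k + n + 1. As dz is a [bd]-cycle, [bd b z] lifts
    through the next differential. The clause on [h] excludes coboundaries. The error [w] dies under
    [bd] and has determinant 0, so c(z) has determinant e. *)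
Definition nonzero_class k :=
  exists (c : nat_trans (P k.+1) (Tab (k + n).+1)) (z : P k.+1 (k + n).+1) (e : int)
    (w : tuples (k + n).+1),
  [/\ forall r y, c r (res_d P k.+1 r y) = 0,
      bd b (res_d P k _ z) = 0,
      forall h : nat_trans (P k) (Tab (k + n).+1), det_form (h _ (res_d P k _ z)) = 0,
      e != 0 &
  [/\ c _ z = pure _ _ (freeg_gen (gen (k + n).+1 : {classic (nat -> _)}) *~ e + w),
      bd b w = 0 &
      det_form (pure (k + n).+1 _ w) = 0]].

Lemma det_form_univ N :
  det_form (pure N N (freeg_gen (gen N : {classic (nat -> free_group N)}))) = 1.
Proof. by rewrite pureU [LHS]det_form_gen. Qed.

Lemma nonzero_class0 : nonzero_class 0.
Proof.
have cd r (y : P 1%N r) : res_aug P r (res_d P 0 r y) = 0.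
  by apply/res_aug_exact; exists y.
pose m r : {additive Pbar r -> Tab n.+1 r} := lead n.+1 \o Pbar_ev r.
have mN s r (f : gr s r) (x : Pbar s) : qn_unit n Pbar s x = 0 ->
    m r (fmap Pbar f x) = fmap (Tab n.+1) f (m s x).
  rewrite -(raddf0 (qn_pi n Pbar s)) => /quot_pi_eq; rewrite subr0 => /qn_ker_Jpow Jx.
  by rewrite -[LHS]/(lead n.+1 (Pbar_ev r (fmap Pbar f x))) nt_natural lead_fmap.
have qn_surj r (x : qn n Pbar r) : exists y, qn_unit n Pbar r y = x.
  exact: qn_pi_surj.
have [c0 [c [c0P cP]]] := connecting (@res_projective _ P 0) cd qn_surj mN.
pose y : Pbar 1 := Pbar_elt x0.
have [z0 z0E] := res_aug_surj P (qn_unit n Pbar 1 y).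
pose u := univ_dprod n.
have [z zE] : exists z, res_d P 0 _ z = yoneda z0 _ u.
  apply/res_aug_exact; rewrite yoneda_comp z0E.
  exact/polynomial_yoneda/qn_polynomial.
(* The lift [c0] is determined only up to the kernel of the unit; v is this error. *)
have [v vE v0] : exists2 v, c0 1%N z0 = y + v & qn_unit n Pbar 1 v = 0.
  by exists (c0 1%N z0 - y); rewrite ?[y + _]addrC ?subrK // raddfB c0P z0E subrr.
have [t tE] := pure_surj (m 1%N v : Tab n.+1 1).
(* On y the cocycle gives the leading term of the product, hence e = 1; on v, where [m] is natural,
   it gives the Yoneda image of t. *)
exists c, z, 1, (yoneda t n.+1 u); split.
- by move=> r a; rewrite cP (_ : res_d P 0 r _ = 0) ?raddf0 //; apply/res_exact; exists a.
- by rewrite zE -bd_natural bd_univ_dprod raddf0.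
- by move=> h; rewrite zE yoneda_comp det_form_yoneda.
- by [].
split.
- rewrite raddfD mulr1z yoneda_comp tE cP zE yoneda_comp vE yonedaD raddfD; congr (_ + _).
    rewrite pureU -[LHS]/(lead n.+1 (Pbar_ev n.+1 (yoneda y n.+1 u))) yoneda_comp Pbar_evE.
    by rewrite yoneda_reduced ?lead_dprod //; apply: (@JpowS _ 0).
  move: u {zE}; apply: (freeg_additive_eq (f := m n.+1 \o yoneda v n.+1)
    (g := yoneda (m 1%N v : Tab n.+1 1) n.+1)) => g.
  rewrite -[LHS]/(m n.+1 (yoneda v n.+1 (freeg_gen g))) !yonedaU.
  exact: mN.
- by rewrite -bd_natural bd_univ_dprod raddf0.
- by rewrite yoneda_comp det_form_yoneda.
Qed.

Lemma nonzero_classS k : nonzero_class k -> nonzero_class k.+1.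
Proof.
move=> [c [z [e [w [cd bdz det0 e0 [cz bdw detw]]]]]].
pose N := (k + n).+1.
pose m r : {additive tuples r -> Tab N.+1 r} := @mu (k + n) r.
have mN s r (f : gr s r) (x : tuples s) : pure N s x = 0 ->
    m r (fmap tuples f x) = fmap (Tab N.+1) f (m s x) by exact: mu_natural.
have [ct [c' [ctP c'P]]] := connecting (@res_projective _ P k.+1) cd (@pure_surj N) mN.
pose g : tuples N := freeg_gen (gen N : {classic (nat -> free_group N)}).
have [z' z'E] : exists z', res_d P k.+1 _ z' = bd b z.
  by apply/res_exact; rewrite bd_natural.
have [v vE v0] : exists2 v, ct N z = g *~ e + w + v & pure N N v = 0.
  exists (ct N z - (g *~ e + w)); first by rewrite [RHS]addrC subrK.
  by rewrite raddfB ctP cz subrr.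
have [t tE] := pure_surj (m N v : Tab N.+1 N).
have bN : (b <= k + n)%N by rewrite addnS leqW ?leq_addl.
(* The sign comes from [mu_bd] on the generic tuple; w disappears under [bd], and v contributes
   [bd b t] because [mu] is natural on the kernel of [pure]. *)
exists c', z', ((-1) ^+ N * e), (bd b t); split.
- by move=> r a; rewrite c'P (_ : res_d P k.+1 r _ = 0) ?raddf0 //; apply/res_exact; exists a.
- by rewrite z'E bd_bd.
- by move=> h; rewrite z'E bd_natural det_form_bd.
- by rewrite mulf_neq0 // signr_eq0.
split.
- have ctz : bd b (ct N z) = bd b g *~ e + bd b v.
    by rewrite vE raddfD raddfD /= bdw addr0 raddfMz.
  rewrite c'P z'E bd_natural ctz !raddfD; congr (_ + _).
    rewrite !raddfMz mulrzA pureU; congr (_ *~ _).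
    exact: mu_bd.
  rewrite bd_natural tE raddf_sum; apply: eq_bigr => i _.
  by rewrite raddfMz mN.
- exact: bd_bd.
- by rewrite bd_natural det_form_bd.
Qed.

Lemma nonzero_classP k : nonzero_class k.
Proof. by elim: k => [|k]; [apply: nonzero_class0|apply: nonzero_classS]. Qed.

Lemma ext_of_neq0 k : exists x : ext_of P (Tab (k + n).+1) k.+1, x <> 0.
Proof.
have [c [z [e [w [cd _ det0 e0 [cz _ detw]]]]]] := nonzero_classP k.
have cK : c \in ker_pred (nt_precomp (res_d P k.+1) : {additive nat_trans (P k.+1) _ -> _}).
  by apply/ker_predP/nat_trans_eq => r y; rewrite /= cd.
exists (\pi_(Quotient.quot (@coboundary _ P (Tab (k + n).+1) k.+1)) (Kernel cK)).
rewrite -[0](raddf0 \pi_(Quotient.quot (@coboundary _ P (Tab (k + n).+1) k.+1))).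
move/quot_pi_eq; rewrite subr0 => /asboolP[h hc]; move/eqP: e0; apply.
(* If c were the coboundary of h, the determinant on z would be 0 instead of e. *)
have := det0 h; rewrite -[h _ _]/(nt_precomp (res_d P k) h _ z) hc /= cz.
rewrite (raddfD (pure _ _)) (raddfD (@det_form _)) /= detw addr0.
by rewrite !raddfMz /= det_form_univ intz.
Qed.
End NonzeroClass.

Lemma ext_of0_neq0 n (P : proj_resolution (qn n Pbar)) : (0 < n)%N ->
  exists x : ext_of P (Tab n) 0, x <> 0.
Proof.
move=> n0; pose c : nat_trans (P 0%N) (Tab n) := nt_comp (qn_diag n) (res_aug P).
have cK : c \in ker_pred (nt_precomp (res_d P 0) : {additive nat_trans (P 0%N) _ -> _}).
  have aug_d r (y : P 1%N r) : res_aug P r (res_d P 0 r y) = 0.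
    by apply/res_aug_exact; exists y.
  apply/ker_predP/nat_trans_eq => r y.
  by rewrite -[LHS]/(qn_diag n r (res_aug P r (res_d P 0 r y))) aug_d raddf0.
exists (\pi_(Quotient.quot (@coboundary _ P (Tab n) 0)) (Kernel cK)).
rewrite -[0](raddf0 \pi_(Quotient.quot (@coboundary _ P (Tab n) 0))).
move/quot_pi_eq; rewrite subr0 => /asboolP /= c0.
have [y yE] := res_aug_surj P (qn_unit n Pbar 1 (Pbar_elt x0)).
have: c 1%N y = 0 by rewrite c0.
rewrite -[c 1%N y]/(qn_diag n 1 (res_aug P 1 y)) yE [LHS]qn_diagE Pbar_evE raddfB !diagU.
(* The form is 1 on the tensor power of [x0]; as n > 0, the tensor power of the class of 1 has a
   zero factor. *)
move/(congr1 (prod_form ord0)); rewrite raddf0 raddfB /= !prod_form_tpure.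
under eq_bigr do rewrite expsum_gen eqxx.
rewrite big1 // (bigD1 (Ordinal n0)) //= abpi1 raddf0 mul0r subr0.
by move/eqP; rewrite oner_eq0.
Qed.

Theorem proposition5 (m n : nat) (hn : (0 < n)%N) (hmn : (n <= m)%N) :
  exists x : Ext (m - n)%N (qn n Pbar) (tensor_functor m ab_functor),
    x <> 0%R.
Proof.
have := subnK hmn; move: (m - n)%N => k <-; clear m hmn.
(* With n = b + 1, the bar differential fixes the first b letters; k = 0 is the case m = n. *)
case: n hn => // b _; case: k => [|k]; first exact: ext_of0_neq0.
exact: ext_of_neq0.
Qed.
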